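(* Let $x_1,\ldots,x_n\in\mathbb{R}^d$ with $n\ge d+1$, and let $w_i>0$ with $\sum_{i=1}^n w_i=1$. Let $(\nu_r,\mu_r,\Sigma_r)_{r\in\mathbb{N}_0}$ be the sequence in $\mathbb{R}_{>0}\times\mathbb{R}^d\times\mathrm{SPD}(d)$ generated by the algorithm aEM or by the algorithm MMF (described in the context) with arbitrary initial values $\nu_0>0$, $\mu_0\in\mathbb{R}^d$, $\Sigma_0\in\mathrm{SPD}(d)$. Then every cluster point (in $\mathbb{R}_{>0}\times\mathbb{R}^d\times\mathrm{SPD}(d)$) of $(\nu_r,\mu_r,\Sigma_r)_r$ is a critical point of $L$.
   Context: $\mathrm{SPD}(d)$ is the set of symmetric positive definite real $d\times d$ matrices. The objective function is $$L(\nu,\mu,\Sigma)=-2\log\Gamma\left(\tfrac{d+\nu}{2}\right)+2\log\Gamma\left(\tfrac{\nu}{2}\right)-\nu\log(\nu)+(d+\nu)\sum_{i=1}^n w_i\log\left(\nu+(x_i-\mu)^{T}\Sigma^{-1}(x_i-\mu)\right)+\log|\Sigma|$$ on $\mathbb{R}_{>0}\times\mathbb{R}^d\times\mathrm{SPD}(d)$; a critical point is a point where the derivatives with respect to $\nu$, $\mu$ and $\Sigma$ all vanish. Let $\psi=\Gamma'/\Gamma$ be the digamma function and $\phi(x)=\psi(x)-\log(x)$, $x>0$. Both algorithms share the following step. Given $(\nu_r,\mu_r,\Sigma_r)$ put $\delta_{i,r}=(x_i-\mu_r)^{T}\Sigma_r^{-1}(x_i-\mu_r)$, $\gamma_{i,r}=\frac{\nu_r+d}{\nu_r+\delta_{i,r}}$,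 and $$\mu_{r+1}=\frac{\sum_{i=1}^n w_i\gamma_{i,r}x_i}{\sum_{i=1}^n w_i\gamma_{i,r}},\qquad \Sigma_{r+1}=\frac{\sum_{i=1}^n w_i\gamma_{i,r}(x_i-\mu_{r+1})(x_i-\mu_{r+1})^{T}}{\sum_{i=1}^n w_i\gamma_{i,r}},\qquad \delta_{i,r+1}=(x_i-\mu_{r+1})^{T}\Sigma_{r+1}^{-1}(x_i-\mu_{r+1}).$$ Set $b_r=\sum_{i=1}^n w_i\left(\frac{\nu_r+d}{\nu_r+\delta_{i,r+1}}-\log\left(\frac{\nu_r+d}{\nu_r+\delta_{i,r+1}}\right)-1\right)$. The $\nu$-updates are: - aEM: $\nu_{r+1}$ is the zero of $\nu\mapsto\phi(\frac{\nu}{2})-\phi(\frac{\nu_r+d}{2})+b_r$. - MMF: $\nu_{r+1}$ is the zero of $\nu\mapsto\phi(\frac{\nu}{2})-\phi(\frac{\nu+d}{2})+b_r$. A sequence ''generated by'' an algorithm is a sequence in $\mathbb{R}_{>0}\times\mathbb{R}^d\times\mathrm{SPD}(d)$ satisfying these recursions for all $r$ (so all required zeros exist and all $\Sigma_r$ are positive definite). *)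

(* Defs.v *)
From mathcomp Require Import all_boot all_order all_algebra.
From mathcomp Require Import all_classical all_reals all_analysis.
Set Implicit Arguments.
Unset Strict Implicit.
Unset Printing Implicit Defensive.
Import Order.TTheory GRing.Theory Num.Theory.
Import numFieldNormedType.Exports.
Local Open Scope classical_set_scope.
Local Open Scope ring_scope.

Section special_functions.
Variable R : realType.

(* Only meaningful for 0 < s, where the integral converges. *)
Definition Gamma (s : R) : R :=
  \int[lebesgue_measure]_(t in `]0, +oo[) (t `^ (s - 1) * expR (- t)).

Definition digamma (s : R) : R := derive1 Gamma s / Gamma s.

Definition phi (s : R) : R := digamma s - ln s.

End special_functions.

Definition spd (R : realType) (d : nat) (Sg : 'M[R]_d) : Prop :=
  Sg^T = Sg /\ forall v : 'cV[R]_d, v != 0 -> 0 < (v^T *m Sg *m v) ord0 ord0.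

Section student_t.
Variables (R : realType) (d n : nat).
Variables (x : 'I_n -> 'cV[R]_d) (w : 'I_n -> R).

(* A state (nu, mu, Sg) lives in the ambient normed space R * R^d * R^(d x d);
   the parameter space is the subset [domain]. *)
Notation state := (R * 'cV[R]_d * 'M[R]_d)%type.

Definition domain : set state := [set z | 0 < z.1.1 /\ spd z.2].

Definition delta (mu : 'cV[R]_d) (Sg : 'M[R]_d) (i : 'I_n) : R :=
  ((x i - mu)^T *m invmx Sg *m (x i - mu)) ord0 ord0.

Definition objective (nu : R) (mu : 'cV[R]_d) (Sg : 'M[R]_d) : R :=
  - 2 * ln (Gamma ((d%:R + nu) / 2)) + 2 * ln (Gamma (nu / 2)) - nu * ln nu
  + (d%:R + nu) * (\sum_(i < n) w i * ln (nu + delta mu Sg i))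
  + ln (\det Sg).

(* In the matrix argument the domain is open in the space of symmetric
   matrices only, so the differential is tested on symmetric directions. *)
Definition critical_point (z : state) : Prop :=
  let: (nu, mu, Sg) := z in
  [/\ is_derive nu 1 (fun t => objective t mu Sg) 0,
      differentiable (fun m => objective nu m Sg) mu /\
      (forall h : 'cV[R]_d, 'd (fun m => objective nu m Sg) mu h = 0)
    & differentiable (objective nu mu) Sg /\
      (forall H : 'M[R]_d, H^T = H -> 'd (objective nu mu) Sg H = 0)].

Definition gamma_weight (nu : R) (mu : 'cV[R]_d) (Sg : 'M[R]_d) (i : 'I_n) : R :=
  (nu + d%:R) / (nu + delta mu Sg i).

Definition mu_update (z : state) : 'cV[R]_d :=
  let: (nu, mu, Sg) := z in
  let g := gamma_weight nu mu Sg in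
  (\sum_(i < n) w i * g i)^-1 *: \sum_(i < n) (w i * g i) *: x i.

Definition Sigma_update (z : state) : 'M[R]_d :=
  let: (nu, mu, Sg) := z in
  let g := gamma_weight nu mu Sg in
  let mu' := mu_update z in
  (\sum_(i < n) w i * g i)^-1 *:
    \sum_(i < n) (w i * g i) *: ((x i - mu') *m (x i - mu')^T).

(* nu is the old value, whereas mu and Sg are the new ones. *)
Definition b_coef (nu : R) (mu : 'cV[R]_d) (Sg : 'M[R]_d) : R :=
  \sum_(i < n) w i *
    (gamma_weight nu mu Sg i - ln (gamma_weight nu mu Sg i) - 1).

(* The functions of nu whose positive zero is the new value of nu. *)
Definition aEM_fun (nu_r b nu : R) : R :=
  phi (nu / 2) - phi ((nu_r + d%:R) / 2) + b.

Definition MMF_fun (nu_r b nu : R) : R :=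
  phi (nu / 2) - phi ((nu + d%:R) / 2) + b.

Definition step (F : R -> R -> R -> R) (z z' : state) : Prop :=
  let: (nu', mu', Sg') := z' in
  [/\ mu' = mu_update z, Sg' = Sigma_update z
    & F z.1.1 (b_coef z.1.1 mu' Sg') nu' = 0].

Definition generated_by (F : R -> R -> R -> R) (z : nat -> state) : Prop :=
  (forall r, domain (z r)) /\ (forall r, step F (z r) (z r.+1)).

End student_t.

(* Main.v *)
Require Import Defs.
From mathcomp Require Import all_boot all_order all_algebra.
From mathcomp Require Import all_classical all_reals all_analysis.
From mathcomp Require Import measurable_realfun ring lra.
Import Order.TTheory GRing.Theory Num.Theory.
Import numFieldNormedType.Exports.
Local Open Scope classical_set_scope.
Local Open Scope ring_scope.

(* Along either algorithm L does not increase. For the (mu, Sigma)-update with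
   s = sum_i w_i gamma_i this follows from ln t <= t - 1, used once for Jensen's
   inequality, once for s, and once for the determinant of s Sigma^-1 Sigma';
   equality forces s = 1, mu' = mu and Sigma' = Sigma. For the nu-update, the
   function whose zero is taken is nondecreasing in nu, and lies above dL/dnu to
   the right of nu_r and below it to the left; this uses that phi is increasing
   and concave, which is read off the expansion
   phi(x) = - sum_k (1/(x+k) - ln(1 + 1/(x+k))).
   L is continuous at a cluster point p, so L(z_r) >= L(p) for all r, and
   one more step taken near p cannot decrease L below L(p). In the limit this
   makes p a fixed point of the (mu, Sigma)-update and a stationary point in nu.
   Continuity of the nu-update is not needed, hence neither is a bound on nu_r. *)

Set Implicit Arguments.
Unset Strict Implicit.

(** * The Gamma and digamma functions *)

Section positive_half_line.
Context {R : realType}.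
Local Notation mu := (@lebesgue_measure R).
Implicit Types (f g F : R -> R).

(** Two obstacles shape the proof beyond the descent. Positive definiteness is assumed for the
    iterates only, so the updated matrix at [p] might be singular. But whether a weighted covariance
    is definite does not depend on the positive weights chosen, and the first update is definite.
    Secondly, derivatives in the matrix argument are awkward to compute. At a fixed point, replacing
    each logarithm of a [nu + delta] term in L by its tangent gives a surrogate u that is minimal
    there while L - u is maximal, so both are stationary along every admissible line. The facts on
    phi rest on the log-convexity of Gamma: its tangent inequality between s and s + 1 gives -1/s <=
    phi(s) <= 0, so the expansion cut after n terms has a remainder in [-1/n, 0], uniformly in s.
    Monotonicity, concavity and continuity of phi are then read off finite sums, and digamma itself
    is never differentiated. *)

Lemma itv0y_bigcup :
  `](0%R : R), +oo[%classic = \bigcup_k `[(k.+1%:R : R)^-1, k.+1%:R]%classic.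
Proof.
apply/seteqP; split => [x|x [k _]] /=; rewrite !in_itv/= ?andbT.
  move=> x0; exists (maxn (Num.trunc x) (Num.trunc x^-1)) => //=.
  rewrite in_itv/=; apply/andP; split.
    rewrite invf_ple ?posrE// ltW//.
    apply: lt_le_trans (truncnS_gt _) _.
    by rewrite ler_nat ltnS leq_maxr.
  rewrite ltW//; apply: lt_le_trans (truncnS_gt _) _.
  by rewrite ler_nat ltnS leq_maxl.
by move=> /andP[+ _]; apply: lt_le_trans; rewrite invr_gt0.
Qed.

Lemma itv_sub_itv0y k :
  `[(k.+1%:R : R)^-1, k.+1%:R] `<=` `](0%R : R), +oo[%classic.
Proof. by rewrite itv0y_bigcup => x kx; exists k. Qed.

Lemma cvg_integral_itv0y f : (forall x : R, 0 < x -> 0 <= f x) ->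
  measurable_fun `](0%R : R), +oo[ f ->
  (\int[mu]_(x in `[((k.+1%:R : R)^-1)%R, (k.+1%:R)%R]) (f x)%:E)%E @[k --> \oo] -->
  (\int[mu]_(x in `](0%R : R), +oo[) (f x)%:E)%E.
Proof.
move=> f0 mf; rewrite itv0y_bigcup.
apply: ge0_nondecreasing_set_cvg_integral => //.
- move=> i j ij; apply/subsetPset => x /=; rewrite !in_itv/= => /andP[h1 h2].
  rewrite (le_trans _ h1) ?(le_trans h2) ?ler_nat//.
  by rewrite lef_pV2 ?posrE// ler_nat.
- move=> k; apply/measurable_EFinP.
  by apply: (measurable_funS _ _ mf) => //; exact: itv_sub_itv0y.
- by move=> k x /itv_sub_itv0y; rewrite /= in_itv/= andbT lee_fin => /f0.
Qed.

Lemma integral_itv_derive f F (a b : R) : 0 < a -> a < b ->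
  (forall x : R, 0 < x -> is_derive x 1 F (f x)) ->
  (forall x : R, 0 < x -> {for x, continuous f}) ->
  (\int[mu]_(x in `[a, b]) (f x)%:E = (F b)%:E - (F a)%:E)%E.
Proof.
move=> a0 ab dF cf; apply: continuous_FTC2 => //.
- apply/continuous_in_subspaceT => x; rewrite inE/= in_itv/= => /andP[ax _].
  by apply: cf; exact: lt_le_trans ax.
- have cF x : 0 < x -> {for x, continuous F}.
    move=> x0; apply/differentiable_continuous/derivable1_diffP.
    by case: (dF x x0).
  split.
  + by move=> x; rewrite in_itv/= => /andP[ax _]; case: (dF x (lt_trans a0 ax)).
  + by apply: cvg_at_right_filter; apply: cF.
  + by apply: cvg_at_left_filter; apply: cF; exact: lt_trans ab.
- move=> x; rewrite in_itv/= => /andP[ax _].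
  by rewrite derive1E; case: (dF x (lt_trans a0 ax)).
Qed.

Lemma measurable_itv0y f : (forall x : R, 0 < x -> {for x, continuous f}) ->
  measurable_fun `](0%R : R), +oo[ f.
Proof.
move=> cf; apply: open_continuous_measurable_fun => //.
by move=> x; rewrite inE/= in_itv/= andbT; exact: cf.
Qed.

(** By monotone convergence the integral is the limit of the differences F(k+1) - F(1/(k+1)), each
    at most C. *)
Lemma integrable_bounded_primitive f F (C : R) :
  (forall x : R, 0 < x -> 0 <= f x) ->
  (forall x : R, 0 < x -> is_derive x 1 F (f x)) ->
  (forall x : R, 0 < x -> {for x, continuous f}) ->
  (forall x : R, 0 < x -> 0 <= F x <= C) ->
  mu.-integrable `]0, +oo[ (EFin \o f).
Proof.
move=> f0 dF cf FC; have mf := measurable_itv0y cf.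
apply/integrableP; split; first exact/measurable_EFinP.
rewrite [X in (X < _)%E](_ : _ =
    (\int[mu]_(x in `](0%R : R), +oo[) (f x)%:E)%E); last first.
  apply: eq_integral => x; rewrite inE/= in_itv/= andbT => x0.
  by rewrite ger0_norm// f0.
apply: (@le_lt_trans _ _ C%:E); last by rewrite ltry.
apply: (cvge_le _ (cvg_integral_itv0y f0 mf)).
near=> k; rewrite (@integral_itv_derive _ F)//.
  rewrite -EFinB lee_fin lerBlDr.
  have /andP[_ h1] := FC k.+1%:R ltac:(by []).
  have /andP[h2 _] := FC (k.+1%:R^-1) ltac:(by rewrite invr_gt0).
  by apply: (le_trans h1); rewrite lerDl.
have k0 : (0 < k)%N by near: k; exists 1%N.
by rewrite (@lt_trans _ _ 1)// ?invf_lt1 ?ltr1n.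
Unshelve. all: by end_near. Qed.

(** This is integration by parts in disguise: [F] is the boundary term, vanishing at both ends, and
    its derivative is the difference of the two integrands. *)
Lemma Rintegral_itv0y_eq f g F :
  (forall x : R, 0 < x -> 0 <= f x) -> (forall x : R, 0 < x -> 0 <= g x) ->
  (forall x : R, 0 < x -> {for x, continuous f}) ->
  (forall x : R, 0 < x -> {for x, continuous g}) ->
  mu.-integrable `]0, +oo[ (EFin \o f) -> mu.-integrable `]0, +oo[ (EFin \o g) ->
  (forall x : R, 0 < x -> is_derive x 1 F (f x - g x)) ->
  F (k.+1%:R) @[k --> \oo] --> (0 : R) ->
  F (k.+1%:R^-1) @[k --> \oo] --> (0 : R) ->
  \int[mu]_(x in `]0, +oo[) f x = \int[mu]_(x in `]0, +oo[) g x.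
Proof.
move=> f0 g0 cf cg If Ig dF Fy F0.
pose I (h : R -> R) k := \int[mu]_(x in `[(k.+1%:R : R)^-1, k.+1%:R]) h x.
have cvgI (h : R -> R) : (forall x : R, 0 < x -> 0 <= h x) ->
    (forall x : R, 0 < x -> {for x, continuous h}) ->
    mu.-integrable `]0, +oo[ (EFin \o h) ->
    I h k @[k --> \oo] --> \int[mu]_(x in `]0, +oo[) h x.
  move=> h0 ch Ih; apply: fine_cvg; rewrite fineK.
    exact: (cvg_integral_itv0y h0 (measurable_itv0y ch)).
  exact: integrable_fin_num.
have FI : \forall k \near \oo, F k.+1%:R - F k.+1%:R^-1 = I f k - I g k.
  near=> k; rewrite -RintegralB//; last 2 first.
    by apply: integrableS If => //; exact: itv_sub_itv0y.
    by apply: integrableS Ig => //; exact: itv_sub_itv0y.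
  rewrite /Rintegral (@integral_itv_derive _ F)//.
    have k0 : (0 < k)%N by near: k; exists 1%N.
    by rewrite (@lt_trans _ _ 1)// ?invf_lt1 ?ltr1n.
  move=> x x0; apply: continuousB; [exact: cf|exact: cg].
have lim0 : I f k - I g k @[k --> \oo] --> (0 : R).
  have h : F k.+1%:R - F k.+1%:R^-1 @[k --> \oo] --> (0 - 0 : R) by exact: cvgB.
  rewrite subr0 in h; apply: cvg_trans h; exact: near_eq_cvg.
have lim1 : I f k - I g k @[k --> \oo] -->
    \int[mu]_(x in `]0, +oo[) f x - \int[mu]_(x in `]0, +oo[) g x.
  by apply: cvgB; exact: cvgI.
by apply/eqP; rewrite -subr_eq0 -(cvg_lim _ lim1)// (cvg_lim _ lim0).
Unshelve. all: by end_near. Qed.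

End positive_half_line.

Section gamma_kernel.
Context {R : realType}.
Local Notation mu := (@lebesgue_measure R).
Implicit Types (s t : R).

Definition gamma_kernel s t : R := t `^ (s - 1) * expR (- t).

Lemma ln_le_subr1 (t : R) : 0 < t -> ln t <= t - 1.
Proof.
move=> t0; have := @le_ln1Dx R (t - 1).
by rewrite (addrC 1) subrK; apply; rewrite ltrBrDl subrr.
Qed.

(** With r = sqrt t one has ln t = 2 ln r <= 2 (r - 1), and t - 1 exceeds this bound by (r -
    1)^2. *)
Lemma ln_eq_subr1 (t : R) : 0 < t -> ln t = t - 1 -> t = 1.
Proof.
move=> t0 h; apply/eqP; apply: contraT => t1.
have r0 : 0 < Num.sqrt t by rewrite sqrtr_gt0.
have tE : t = Num.sqrt t ^+ 2 by rewrite sqr_sqrtr// ltW.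
have r1 : Num.sqrt t != 1 by apply: contra t1 => /eqP r1; rewrite tE r1 expr1n.
have := ln_le_subr1 r0; move: h; rewrite {1 2}tE lnXn// => h.
have : 0 < (Num.sqrt t - 1) ^+ 2 by rewrite exprn_even_gt0//= subr_eq0.
by rewrite -[ln _ *+ 2]mulr_natr in h; nra.
Qed.

Lemma powR_gt0E s t : 0 < t -> t `^ s = expR (s * ln t).
Proof. by move=> t0; rewrite /powR gt_eqF. Qed.

Lemma gamma_kernelE s t : 0 < t ->
  gamma_kernel s t = expR ((s - 1) * ln t) * expR (- t).
Proof. by move=> t0; rewrite /gamma_kernel powR_gt0E. Qed.

Lemma gamma_kernel_ge0 s t : 0 <= gamma_kernel s t.
Proof. by rewrite mulr_ge0 ?powR_ge0 ?expR_ge0. Qed.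

(** The left side is largest at t = s; the bound is ln (t / s) <= t / s - 1 multiplied by s. *)
Lemma powR_expRN_bound s t : 0 < s -> 0 < t ->
  t `^ s * expR (- t) <= expR (s * ln s - s).
Proof.
move=> s0 t0; rewrite powR_gt0E// -expRD ler_expR.
have ts0 : 0 < t / s by rewrite divr_gt0.
have := ln_le_subr1 ts0; rewrite ln_div ?posrE// => h.
have := ler_wpM2l (ltW s0) h.
rewrite (_ : s * (t / s - 1) = t - s); last by field; rewrite gt_eqF.
by lra.
Qed.

Lemma continuous_powR s t : 0 < t -> {for t, continuous (fun t : R => t `^ s)}.
Proof.
move=> t0; apply/differentiable_continuous/derivable1_diffP.
by case: (is_derive1_powR s t0).
Qed.

Lemma continuous_gamma_kernel s t : 0 < t ->
  {for t, continuous (gamma_kernel s)}.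
Proof.
move=> t0; apply: continuousM; first exact: continuous_powR.
apply: continuous_comp; first exact: continuousN.
exact: continuous_expR.
Qed.

(** Comparison with the derivative [f] of the bounded function 1 - 1/(1 + t^s). It behaves like
    t^(s-1) at 0 and like t^(-s-1) at infinity, so one dominating function serves both ends. *)
Lemma integrable_gamma_kernel s : 0 < s ->
  mu.-integrable `]0, +oo[ (EFin \o gamma_kernel s).
Proof.
move=> s0.
(* [C] bounds e^(-t) (1 + t^s)^2 <= e^(-t) (2 + 2 t^(2s)); the exponential is the maximum of t^(2s)
   e^(-t). *)
pose C : R := 2 + 2 * expR (2 * s * ln (2 * s) - 2 * s).
pose F t : R := 1 - (1 + t `^ s)^-1.
pose f t := s * t `^ (s - 1) / (1 + t `^ s) ^+ 2.
have p0 t : 0 < 1 + t `^ s by rewrite ltr_pwDl// powR_ge0.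
have If : mu.-integrable `]0, +oo[ (EFin \o f).
  apply: (@integrable_bounded_primitive _ _ F 1).
  - by move=> t _; rewrite divr_ge0 ?sqr_ge0// mulr_ge0 ?powR_ge0 ?ltW.
  - move=> t t0.
    have d1 := is_derive1_powR s t0.
    have d2 : is_derive t 1 (fun t : R => (1 + t `^ s)^-1)
        (- (1 + t `^ s) ^- 2 *: (0 + s * t `^ (s - 1))).
      by apply: is_deriveV; rewrite gt_eqF.
    apply: is_derive_eq.
    by rewrite /f !add0r mul1r scaleNr opprK [RHS]mulrC.
  - move=> t t0; apply: continuousM.
      by apply: continuousM; [exact: cst_continuous|exact: continuous_powR].
    apply: continuousV; first by rewrite expf_neq0// gt_eqF.
    have c : {for t, continuous (fun t : R => 1 + t `^ s)}.
      by apply: continuousD; [exact: cst_continuous|exact: continuous_powR].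
    exact: (continuousM c c).
  - move=> t t0; rewrite /F lerBlDr lerDl subr_ge0 invr_ge0.
    rewrite [in X in _ && X]ltW// andbT.
    by rewrite invf_le1// lerDl powR_ge0.
apply: (@le_integrable _ _ _ mu _ _ _ (EFin \o (fun t => C / s * f t))) => //.
- have mk := measurable_itv0y (@continuous_gamma_kernel s).
  exact/measurable_EFinP.
- move=> t /=; rewrite in_itv/= andbT => t0; rewrite lee_fin.
  rewrite ger0_norm ?gamma_kernel_ge0//; apply: le_trans (ler_norm _).
  rewrite /f /gamma_kernel.
  rewrite (_ : C / s * _ = t `^ (s - 1) * (C / (1 + t `^ s) ^+ 2)); last first.
    by field; rewrite (gt_eqF s0) gt_eqF.
  rewrite ler_wpM2l ?powR_ge0// ler_pdivlMr ?exprn_gt0//.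
  have s20 : 0 < 2 * s by rewrite mulr_gt0.
  have h := powR_expRN_bound s20 t0.
  have e1 : expR (- t) <= 1 by rewrite -expR0 ler_expR oppr_le0 ltW.
  have e2 : t `^ (2 * s) = (t `^ s) ^+ 2.
    by rewrite !powR_gt0E// -expRM_natl; congr expR; ring.
  rewrite e2 in h; rewrite /C.
  have e0 := expR_gt0 (- t).
  have : expR (- t) * (1 + t `^ s) ^+ 2 <= expR (- t) * (2 + 2 * (t `^ s) ^+ 2).
    rewrite ler_wpM2l ?(ltW e0)// -subr_ge0.
    by rewrite (_ : _ - _ = (1 - t `^ s) ^+ 2) ?sqr_ge0//; ring.
  by nra.
- rewrite (_ : EFin \o _ = (fun t => (C / s)%:E * (EFin \o f) t)%E)//.
  exact: integrableZl.
Qed.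

End gamma_kernel.

Section Gamma_function.
Context {R : realType}.
Local Notation mu := (@lebesgue_measure R).
Implicit Types (s t : R).

Lemma GammaE s : Gamma s = \int[mu]_(t in `]0, +oo[) gamma_kernel s t.
Proof. by []. Qed.

Lemma Gamma_gt0 s : 0 < s -> 0 < Gamma s.
Proof.
move=> s0.
(* A lower bound of the kernel on [1, 2], where t^(s-1) >= 2^(-|s-1|) and e^(-t) >= e^(-2). *)
pose c : R := expR (- `|s - 1| * ln 2 - 2).
have cle t : 1 <= t <= 2 -> c <= gamma_kernel s t.
  move=> /andP[t1 t2]; have t0 : 0 < t by exact: lt_le_trans t1.
  rewrite gamma_kernelE// -expRD ler_expR lerD ?lerN2// mulNr.
  have l0 := ln_ge0 t1.
  have l2 : ln t <= ln 2 by rewrite ler_ln ?posrE.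
  rewrite lerNl -mulNr; apply: (@le_trans _ _ (`|s - 1| * ln t)).
    by rewrite ler_wpM2r// -normrN ler_norm.
  by rewrite ler_wpM2l.
have sub : `[1, 2] `<=` `](0%R : R), +oo[%classic.
  by move=> t /=; rewrite !in_itv/= andbT => /andP[t1 _]; exact: lt_le_trans t1.
have If := integrable_gamma_kernel s0.
have mk := measurable_itv0y (@continuous_gamma_kernel _ s).
have : (c%:E <= \int[mu]_(t in `]0%R, +oo[) (gamma_kernel s t)%:E)%E.
  apply: (@le_trans _ _ (\int[mu]_(t in `[1%R, 2%R]) (gamma_kernel s t)%:E)%E).
    have -> : c%:E = (\int[mu]_(t in `[1%R, 2%R]) c%:E)%E.
      rewrite integral_cst//= lebesgue_measure_itv/= lte_fin ltr1n -EFinB.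
      by rewrite -EFinM; congr EFin; rewrite (_ : 2 - 1 = 1) ?mulr1//; ring.
    apply: ge0_le_integral => //=.
    - by move=> t _; rewrite lee_fin expR_ge0.
    - apply/measurable_EFinP; exact: (measurable_funS _ sub).
  apply: ge0_subset_integral => //.
    exact/measurable_EFinP.
  by move=> t _; rewrite lee_fin gamma_kernel_ge0.
rewrite GammaE /Rintegral => h.
have fin : (\int[mu]_(t in `]0%R, +oo[) (gamma_kernel s t)%:E)%E \is a fin_num.
  exact: integrable_fin_num.
by rewrite -lte_fin fineK//; apply: lt_le_trans h; rewrite lte_fin expR_gt0.
Qed.

Lemma GammaS s : 0 < s -> Gamma (s + 1) = s * Gamma s.
Proof.
move=> s0; rewrite !GammaE -RintegralZl//; last exact: integrable_gamma_kernel.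
have s1 : 0 < s + 1 by rewrite addr_gt0.
apply: (@Rintegral_itv0y_eq _ _ _ (fun t => - (t `^ s * expR (- t)))).
- by move=> t _; exact: gamma_kernel_ge0.
- by move=> t _; rewrite mulr_ge0 ?gamma_kernel_ge0// ltW.
- by move=> t t0; exact: continuous_gamma_kernel.
- move=> t t0; apply: continuousM; first exact: cst_continuous.
  exact: continuous_gamma_kernel.
- exact: integrable_gamma_kernel.
- rewrite (_ : EFin \o _ = (fun t => s%:E * (EFin \o gamma_kernel s) t)%E)//.
  by apply: integrableZl => //; exact: integrable_gamma_kernel.
- move=> t t0; have d1 := is_derive1_powR s t0.
  apply: is_derive_eq; rewrite /gamma_kernel addrK.
  by rewrite /GRing.scale/=; ring.
- rewrite -oppr0; apply: cvgN.
  (* At infinity t^s e^(-t) is t^(s+1) e^(-t) divided by t, and the numerator is bounded. *)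
  apply: (@squeeze_cvgr _ _ _ _ (fun=> 0)
      (fun k => expR ((s + 1) * ln (s + 1) - (s + 1)) * k.+1%:R^-1)).
  + apply: nearW => k; rewrite mulr_ge0 ?powR_ge0 ?expR_ge0//=.
    rewrite ler_pdivlMr//; apply: le_trans (powR_expRN_bound s1 (ltr0Sn R k)).
    rewrite !powR_gt0E// mulrDl mul1r (expRD (s * _)) lnK ?posrE//.
    by rewrite mulrAC.
  + exact: cvg_cst.
  + rewrite -[X in _ --> X](mulr0 (expR ((s + 1) * ln (s + 1) - (s + 1)))).
    by apply: cvgMr; exact: cvg_harmonic.
- rewrite -oppr0; apply: cvgN.
  apply: (@squeeze_cvgr _ _ _ _ (fun=> 0) (fun k => k.+1%:R^-1 `^ s)).
  + apply: nearW => k; rewrite mulr_ge0 ?powR_ge0 ?expR_ge0//=.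
    by rewrite ler_piMr ?powR_ge0// -expR0 ler_expR oppr_le0 invr_ge0.
  + exact: cvg_cst.
  + move: (powR_cvg0 s0) => /cvg_at_rightP; apply; split.
      by move=> k; rewrite invr_gt0.
    exact: cvg_harmonic.
Qed.

Definition dgamma_kernel s t : R := ln t * gamma_kernel s t.

Lemma derivable_gamma_kernel s t : 0 < t ->
  is_derive s 1 (gamma_kernel ^~ t) (dgamma_kernel s t).
Proof.
move=> t0.
have d : is_derive s 1 (fun s => expR ((s - 1) * ln t) * expR (- t))
    (dgamma_kernel s t).
  apply: is_derive_eq; rewrite /dgamma_kernel gamma_kernelE//.
  by rewrite /GRing.scale/=; ring.
rewrite (_ : gamma_kernel ^~ t = fun s => expR ((s - 1) * ln t) * expR (- t))//.
by apply/funext => u; rewrite gamma_kernelE.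
Qed.

Lemma partial1of2_gamma_kernel s t : 0 < t ->
  partial1of2 gamma_kernel s t = dgamma_kernel s t.
Proof.
by move=> t0; rewrite partial1of2E; case: (derivable_gamma_kernel s t0).
Qed.

(** Apply ln u <= u - 1 to u = t^e and to u = t^(-e). This trades the logarithm in the
    differentiated kernel for small shifts of the exponent. *)
Lemma normr_ln_le (e t : R) : 0 < e -> 0 < t ->
  `|ln t| <= (t `^ e + t `^ (- e)) / e.
Proof.
move=> e0 t0; rewrite ler_pdivlMr// -(gtr0_norm e0) -normrM (gtr0_norm e0).
have h1 := ln_le_subr1 (powR_gt0 e t0).
have h2 := ln_le_subr1 (powR_gt0 (- e) t0).
have p1 := powR_gt0 e t0; have p2 := powR_gt0 (- e) t0.
rewrite !ln_powR in h1 h2.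
by rewrite ler_norml; apply/andP; split; lra.
Qed.

(** The power is monotone in its exponent, increasing for t >= 1 and decreasing for t <= 1, so one
    of the two end exponents always dominates. *)
Lemma gamma_kernel_le (u v s t : R) : 0 < t -> u <= s -> s <= v ->
  gamma_kernel s t <= gamma_kernel u t + gamma_kernel v t.
Proof.
move=> t0 us sv; rewrite !gamma_kernelE// -mulrDl ler_wpM2r ?expR_ge0//.
have [t1|t1] := leP 1 t.
  apply: ler_wpDl; first exact: expR_ge0.
  by rewrite ler_expR ler_wpM2r ?lerB// ln_ge0.
apply: ler_wpDr; first exact: expR_ge0.
by rewrite ler_expR ler_wnM2r ?lerB// ln_le0// ltW.
Qed.

Lemma gamma_kernelMpow (e s t : R) : 0 < t ->
  t `^ e * gamma_kernel s t = gamma_kernel (s + e) t.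
Proof.
move=> t0; rewrite !gamma_kernelE// powR_gt0E// mulrA -expRD.
by congr (expR _ * _); ring.
Qed.

(** The product of the bound on |ln t| for e = s/4 with the kernels at s/2 and 2s, expanded. The
    exponents are s/2 -+ s/4 and 2s -+ s/4; the choice of e keeps the smallest positive, so every
    summand is integrable. *)
Definition dgamma_dominator s t : R := 4 / s *
  (gamma_kernel (s / 4) t + gamma_kernel (3 * s / 4) t +
   (gamma_kernel (7 * s / 4) t + gamma_kernel (9 * s / 4) t)).

Lemma dgamma_kernel_le (s r t : R) : 0 < s -> 0 < t -> s / 2 < r < 2 * s ->
  `|dgamma_kernel r t| <= dgamma_dominator s t.
Proof.
move=> s0 t0 /andP[/ltW r1 /ltW r2].
have e0 : 0 < s / 4 by rewrite divr_gt0.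
rewrite /dgamma_kernel normrM (ger0_norm (gamma_kernel_ge0 _ _)).
have h1 := normr_ln_le e0 t0.
have h2 := gamma_kernel_le t0 r1 r2.
apply: (le_trans (ler_pM _ _ h1 h2)); rewrite ?normr_ge0 ?gamma_kernel_ge0//.
rewrite mulrAC mulrDl !mulrDr !gamma_kernelMpow// /dgamma_dominator.
rewrite invf_div mulrC.
rewrite (_ : s / 2 + s / 4 = 3 * s / 4); last by field.
rewrite (_ : 2 * s + s / 4 = 9 * s / 4); last by field.
rewrite (_ : s / 2 + - (s / 4) = s / 4); last by field.
rewrite (_ : 2 * s + - (s / 4) = 7 * s / 4); last by field.
rewrite ler_wpM2l ?divr_ge0 ?(ltW s0)//.
by rewrite le_eqVlt; apply/orP; left; apply/eqP; ring.
Qed.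

Lemma integrable_dgamma_dominator s : 0 < s ->
  mu.-integrable `]0, +oo[ (EFin \o dgamma_dominator s).
Proof.
move=> s0.
have I r : 0 < r -> mu.-integrable `]0, +oo[ (EFin \o gamma_kernel r).
  exact: integrable_gamma_kernel.
rewrite (_ : EFin \o _ = (fun t => (4 / s)%:E *
  ((EFin \o gamma_kernel (s / 4)) \+ (EFin \o gamma_kernel (3 * s / 4)) \+
  ((EFin \o gamma_kernel (7 * s / 4)) \+
   (EFin \o gamma_kernel (9 * s / 4)))) t)%E)//.
apply: integrableZl => //; apply: integrableD => //; apply: integrableD => //;
  apply: I; rewrite !(divr_gt0, mulr_gt0)//.
Qed.

Lemma Gamma_derive s : 0 < s ->
  is_derive s 1 (@Gamma R) (\int[mu]_(t in `]0, +oo[) dgamma_kernel s t).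
Proof.
move=> s0.
have Is : `]s / 2, 2 * s[%classic s.
  by rewrite /= in_itv/=; apply/andP; split; lra.
have intf r : `]s / 2, 2 * s[%classic r ->
    mu.-integrable `]0, +oo[ (EFin \o gamma_kernel r).
  rewrite /= in_itv/= => /andP[r1 _]; apply: integrable_gamma_kernel.
  by apply: lt_trans r1; rewrite divr_gt0.
have der r t : `]s / 2, 2 * s[%classic r -> `]0, +oo[%classic t ->
    derivable (gamma_kernel ^~ t) r 1.
  rewrite /= !in_itv/= andbT => _ t0.
  by case: (derivable_gamma_kernel r t0).
have dom0 t : 0 <= dgamma_dominator s t.
  apply: mulr_ge0; first by rewrite divr_ge0// ltW.
  by rewrite !addr_ge0 ?gamma_kernel_ge0.
have dom r t : `]s / 2, 2 * s[%classic r -> `]0, +oo[%classic t ->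
    `|partial1of2 gamma_kernel r t| <= dgamma_dominator s t.
  rewrite /= !in_itv/= andbT => rs t0.
  by rewrite partial1of2_gamma_kernel// dgamma_kernel_le.
have mB : measurable (`]0%R, +oo[%classic : set (measurableTypeR R)).
  exact: measurable_itv.
apply: DeriveDef.
  exact: (derivable_under_integral mB Is intf der dom0
    (integrable_dgamma_dominator s0) dom).
rewrite -derive1E.
rewrite (differentiation_under_integral mB Is intf der dom0
  (integrable_dgamma_dominator s0) dom).
apply: eq_Rintegral => t; rewrite inE/= in_itv/= andbT => t0.
exact: partial1of2_gamma_kernel.
Qed.

End Gamma_function.

Local Opaque Gamma.

Lemma is_derive_continuous {R : realType} (f : R -> R) (x df : R) :
  is_derive x 1 f df -> {for x, continuous f}.
Proof. by case=> d _; apply/differentiable_continuous/derivable1_diffP. Qed.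

Lemma le0_derive_nonincr {R : realType} (f g : R -> R) (a b : R) : a <= b ->
  (forall x, a <= x <= b -> is_derive x 1 f (g x)) ->
  (forall x, a <= x <= b -> g x <= 0) -> f b <= f a.
Proof.
move=> ab df g0.
have [x xab||c] := @MVT_segment _ f g _ _ ab.
- by apply: df; move: xab; rewrite in_itv/= => /andP[/ltW-> /ltW->].
- apply: derivable_within_continuous => x; rewrite in_itv/= => xab.
  by case: (df x xab).
rewrite in_itv/= => cab h; rewrite -subr_le0 h mulr_le0_ge0 ?subr_ge0//.
exact: g0.
Qed.

Lemma le0_derive_nonincr_pos {R : realType} (f g : R -> R) (a b : R) :
  (forall x : R, 0 < x -> is_derive x 1 f (g x)) ->
  (forall x : R, 0 < x -> g x <= 0) -> 0 < a -> a <= b -> f b <= f a.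
Proof.
move=> df g0 a0 ab; apply: (@le0_derive_nonincr _ f g) => // x /andP[ax _].
- by apply: df; exact: lt_le_trans ax.
- by apply: g0; exact: lt_le_trans ax.
Qed.

(** Serves to drop the remainders of the expansion of [phi], which are of order 1/(n+1). *)
Lemma ge0_limit_harmonic {R : realType} (C a : R) :
  (forall n, - C / n.+1%:R <= a) -> 0 <= a.
Proof.
move=> h; have : - C / n.+1%:R @[n --> \oo] --> - C * 0.
  by apply: cvgMr; exact: cvg_harmonic.
rewrite mulr0 => /cvgr_to_le; apply; exact: nearW.
Qed.

(** * Log-convexity of Gamma, and monotonicity, concavity and continuity of phi *)

Section digamma_function.
Context {R : realType}.
Local Notation mu := (@lebesgue_measure R).
Implicit Types (s t x y : R).

Lemma integrable_dgamma_kernel s : 0 < s ->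
  mu.-integrable `]0, +oo[ (EFin \o dgamma_kernel s).
Proof.
move=> s0.
apply: (@le_integrable _ _ _ mu _ _ _ (EFin \o dgamma_dominator s)) => //.
- have mk : measurable_fun `](0%R : R), +oo[ (dgamma_kernel s).
    apply: measurable_itv0y => t t0; apply: continuousM.
      exact: continuous_ln.
    exact: continuous_gamma_kernel.
  exact/measurable_EFinP.
- move=> t /=; rewrite in_itv/= andbT => t0; rewrite lee_fin.
  apply: le_trans (ler_norm _); apply: dgamma_kernel_le => //.
  by apply/andP; split; lra.
- exact: integrable_dgamma_dominator.
Qed.

Lemma digammaE s : 0 < s ->
  digamma s * Gamma s = \int[mu]_(t in `]0, +oo[) dgamma_kernel s t.
Proof.
move=> s0; rewrite /digamma divfK ?gt_eqF ?Gamma_gt0// derive1E.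
by case: (Gamma_derive s0).
Qed.

(* Jensen's inequality for the measure t^(a-1) e^(-t) dt / Gamma a, obtained
   from the tangent line of exp at c = (b - a) * digamma a. *)
Lemma Gamma_tangent (a b : R) : 0 < a -> 0 < b ->
  Gamma a * expR ((b - a) * digamma a) <= Gamma b.
Proof.
move=> a0 b0; set c := (b - a) * digamma a.
have Ia := integrable_gamma_kernel a0; have Ib := integrable_gamma_kernel b0.
have Id := integrable_dgamma_kernel a0.
pose g1 t := expR c * (1 - c) * gamma_kernel a t.
pose g2 t := expR c * (b - a) * dgamma_kernel a t.
have I1 : mu.-integrable `]0, +oo[ (EFin \o g1).
  rewrite (_ : EFin \o _ =
    (fun t => (expR c * (1 - c))%:E * (EFin \o gamma_kernel a) t)%E)//.
  exact: integrableZl.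
have I2 : mu.-integrable `]0, +oo[ (EFin \o g2).
  rewrite (_ : EFin \o _ =
    (fun t => (expR c * (b - a))%:E * (EFin \o dgamma_kernel a) t)%E)//.
  exact: integrableZl.
have -> : Gamma a * expR c = \int[mu]_(t in `]0, +oo[) (g1 t + g2 t).
  rewrite RintegralD// !RintegralZl// -digammaE// -GammaE.
  transitivity (expR c * Gamma a * (1 - c + (b - a) * digamma a)); last by ring.
  by rewrite -/c subrK mulr1 mulrC.
rewrite GammaE; apply: le_Rintegral => //.
  rewrite (_ : EFin \o _ = ((EFin \o g1) \+ (EFin \o g2))%E)//.
  exact: integrableD.
move=> t; rewrite /= in_itv/= andbT => t0.
rewrite /g1 /g2 /dgamma_kernel.
rewrite (_ : gamma_kernel b t =
  expR c * expR ((b - a) * ln t - c) * gamma_kernel a t); last first.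
  rewrite !gamma_kernelE// -!expRD; congr expR; ring.
rewrite (_ : _ + _ = expR c * (1 + ((b - a) * ln t - c)) * gamma_kernel a t);
  last by ring.
rewrite ler_wpM2r ?gamma_kernel_ge0// ler_wpM2l ?expR_ge0//.
exact: expR_ge1Dx.
Qed.

Lemma lnGamma_tangent (a b : R) : 0 < a -> 0 < b ->
  (b - a) * digamma a <= ln (Gamma b) - ln (Gamma a).
Proof.
move=> a0 b0; have := Gamma_tangent a0 b0.
move: (Gamma a) (Gamma b) (Gamma_gt0 a0) (Gamma_gt0 b0) => A B A0 B0 AB.
rewrite -ln_div ?posrE// -ler_expR lnK ?posrE ?divr_gt0//.
by rewrite ler_pdivlMr// mulrC.
Qed.

Lemma lnGamma_derive s : 0 < s ->
  is_derive s 1 (fun s => ln (Gamma s)) (digamma s).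
Proof.
move=> s0; have G0 := Gamma_gt0 s0.
have dl := is_derive1_ln G0; have dG := Gamma_derive s0.
apply: is_derive_eq (is_derive1_comp dl dG) _.
by rewrite -digammaE// mulrCA mulVf ?mulr1// gt_eqF.
Qed.

Lemma lnGammaS s : 0 < s -> ln (Gamma (s + 1)) = ln s + ln (Gamma s).
Proof. by move=> s0; rewrite GammaS// lnM// ?posrE ?Gamma_gt0. Qed.

Lemma digammaS s : 0 < s -> digamma (s + 1) = digamma s + s^-1.
Proof.
move=> s0; have s1 : 0 < s + 1 by rewrite addr_gt0.
have d1 := lnGamma_derive s1.
have d2 : is_derive s 1 (fun s => ln (Gamma (s + 1))) (digamma (s + 1)).
  have ds : is_derive s 1 (fun s => s + 1) (1 + 0 : R) by exact: is_deriveD.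
  have := @is_derive1_comp _ _ (fun s => s + 1) _ _ _ d1 ds.
  by rewrite addr0 mulr1.
have d3 : is_derive s 1 (fun s => ln (Gamma (s + 1))) (s^-1 + digamma s).
  have dl := is_derive1_ln s0; have dG := lnGamma_derive s0.
  apply: near_eq_is_derive (is_deriveD dl dG).
  near=> t; rewrite lnGammaS//; near: t; exact: lt_nbhsr.
by have [_ <-] := d2; have [_ ->] := d3; rewrite addrC.
Unshelve. all: by end_near. Qed.

(** The tangent of ln Gamma at s is evaluated at s + 1, where ln Gamma has grown by ln s. The
    tangent at s + 1 evaluated at s gives the lower bound [phi_geNV]. *)
Lemma phi_le0 s : 0 < s -> phi s <= 0.
Proof.
move=> s0; have s1 : 0 < s + 1 by rewrite addr_gt0.
have := lnGamma_tangent s0 s1; rewrite lnGammaS// /phi.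
by lra.
Qed.

Lemma phi_geNV s : 0 < s -> - s^-1 <= phi s.
Proof.
move=> s0; have s1 : 0 < s + 1 by rewrite addr_gt0.
have := lnGamma_tangent s1 s0; rewrite lnGammaS// digammaS// /phi.
by lra.
Qed.

Definition phi_incr s : R := s^-1 - ln (s + 1) + ln s.

Lemma phi_incrE s : 0 < s -> phi (s + 1) = phi s + phi_incr s.
Proof. by move=> s0; rewrite /phi digammaS// /phi_incr; ring. Qed.

(** The expansion is kept finite with its remainder [phi (s + n%:R)], which the two bounds on [phi]
    control; no infinite sum has to be handled. *)
Lemma phi_series s n : 0 < s ->
  phi s = phi (s + n%:R) - \sum_(k < n) phi_incr (s + k%:R).
Proof.
move=> s0; elim: n => [|n ih]; first by rewrite big_ord0 addr0 subr0.
rewrite big_ord_recr/= -natr1 addrA phi_incrE ?ltr_wpDr//.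
by rewrite {1}ih; ring.
Qed.

Lemma phi_incr_derive s : 0 < s ->
  is_derive s 1 phi_incr (- (s ^+ 2 * (s + 1))^-1).
Proof.
move=> s0; have s1 : 0 < s + 1 by rewrite addr_gt0.
have d0 : is_derive s 1 (fun s : R => s^-1) (- s ^- 2 *: 1).
  by apply: is_deriveV; rewrite gt_eqF.
have ds : is_derive s 1 (fun s => s + 1) (1 + 0 : R) by exact: is_deriveD.
have d1 := @is_derive1_comp _ _ (fun s => s + 1) _ _ _ (is_derive1_ln s1) ds.
have d2 := is_derive1_ln s0.
apply: is_derive_eq (is_deriveD (is_deriveB d0 d1) d2) _.
by rewrite /GRing.scale/=; field; rewrite !gt_eqF.
Qed.

Lemma phi_nondecr x y : 0 < x -> x <= y -> phi x <= phi y.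
Proof.
move=> x0 xy; have y0 := lt_le_trans x0 xy.
(* The constant is 1 because only the remainder of [y] needs its lower bound -1/(n+1); that of [x]
   is dropped by its sign. *)
rewrite -subr_ge0; apply: (@ge0_limit_harmonic _ 1) => n.
rewrite (phi_series n.+1 x0) (phi_series n.+1 y0).
have hx : phi (x + n.+1%:R) <= 0 by rewrite phi_le0// ltr_wpDr.
have hy : - n.+1%:R^-1 <= phi (y + n.+1%:R).
  apply: le_trans (phi_geNV _); last by rewrite ltr_wpDr.
  by rewrite lerN2 lef_pV2 ?posrE ?ltr_wpDr// lerDr ltW.
have hS : \sum_(k < n.+1) phi_incr (y + k%:R) <=
    \sum_(k < n.+1) phi_incr (x + k%:R).
  apply: ler_sum => k _.
  apply: (le0_derive_nonincr_pos phi_incr_derive); rewrite ?lerD2r ?ltr_wpDr//.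
  by move=> t t0; rewrite oppr_le0 invr_ge0 mulr_ge0 ?sqr_ge0// addr_ge0// ltW.
move: hx hy hS; set u := n.+1%:R^-1; set X := \sum_(_ < _) _;
  set Y := \sum_(_ < _) _ => hx hy hS; lra.
Qed.

(** Concavity of [phi] in the form of shrinking increments. It holds term by term: the derivative
    -1/(t^2 (t+1)) of [phi_incr] increases, so [phi_incr t - phi_incr (t + c)] decreases in t. *)
Lemma phi_shift_nonincr (c x y : R) : 0 <= c -> 0 < x -> x <= y ->
  phi (y + c) - phi y <= phi (x + c) - phi x.
Proof.
move=> c0 x0 xy; have y0 := lt_le_trans x0 xy.
have xc0 : 0 < x + c by rewrite ltr_wpDr.
have yc0 : 0 < y + c by rewrite ltr_wpDr.
(* Two of the four remainders, those of [y] and [x + c], enter with a plus sign and cost 1/(n+1)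
   each. *)
rewrite -subr_ge0; apply: (@ge0_limit_harmonic _ 2) => n.
rewrite (phi_series n.+1 x0) (phi_series n.+1 y0).
rewrite (phi_series n.+1 xc0) (phi_series n.+1 yc0).
have le0 (z : R) : 0 < z -> phi (z + n.+1%:R) <= 0.
  by move=> z0; rewrite phi_le0// ltr_wpDr.
have ge0 (z : R) : 0 < z -> - n.+1%:R^-1 <= phi (z + n.+1%:R).
  move=> z0; apply: le_trans (phi_geNV _); last by rewrite ltr_wpDr.
  by rewrite lerN2 lef_pV2 ?posrE ?ltr_wpDr// lerDr ltW.
have h1 := le0 _ x0; have h2 := ge0 _ y0; have h3 := le0 _ yc0.
have h4 := ge0 _ xc0.
have hS : \sum_(k < n.+1) (phi_incr (y + k%:R) - phi_incr (y + c + k%:R)) <=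
    \sum_(k < n.+1) (phi_incr (x + k%:R) - phi_incr (x + c + k%:R)).
  apply: ler_sum => k _; rewrite ![_ + c + _]addrAC.
  pose f t := phi_incr t - phi_incr (t + c).
  rewrite -/(f (y + k%:R)) -/(f (x + k%:R)).
  pose g t := - (t ^+ 2 * (t + 1))^-1 - - ((t + c) ^+ 2 * (t + c + 1))^-1.
  apply: (@le0_derive_nonincr_pos _ f g); rewrite ?lerD2r ?ltr_wpDr//.
    move=> t t0; have tc0 : 0 < t + c by rewrite ltr_wpDr.
    have ds : is_derive t 1 (fun s => s + c) (1 + 0 : R) by exact: is_deriveD.
    have d1 := @is_derive1_comp _ _ (fun s => s + c) _ _ _
      (phi_incr_derive tc0) ds.
    apply: is_derive_eq (is_deriveB (phi_incr_derive t0) d1) _.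
    by rewrite addr0 mulr1.
  move=> t t0; have tc0 : 0 < t + c by rewrite ltr_wpDr.
  have p1 : 0 < t ^+ 2 * (t + 1) by rewrite mulr_gt0 ?exprn_gt0// addr_gt0.
  have p2 : 0 < (t + c) ^+ 2 * (t + c + 1).
    by rewrite mulr_gt0 ?exprn_gt0// addr_gt0.
  rewrite /g opprK addrC subr_le0 lef_pV2 ?posrE//.
  apply: ler_pM; rewrite ?sqr_ge0 ?addr_ge0 ?(ltW t0)//.
    by rewrite ler_sqr ?nnegrE ?(ltW t0) ?(ltW tc0)// lerDl.
  by rewrite lerD2r lerDl.
rewrite !sumrB in hS.
move: h1 h2 h3 h4 hS; set u := n.+1%:R^-1.
set A := \sum_(_ < _) _; set B := \sum_(_ < _) _.
set C := \sum_(_ < _) _; set D := \sum_(_ < _) _ => h1 h2 h3 h4 hS; lra.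
Qed.

(** A uniform limit of continuous sums: the remainders at [x] and at [y] both lie in [-1/n, 0], so
    they differ by less than e/2 once n is large. *)
Lemma continuous_phi x : 0 < x -> {for x, continuous (@phi R)}.
Proof.
move=> x0; apply/cvgrPdist_lt => e e0.
near \oo => n.
have cS : {for x, continuous (fun y => \sum_(k < n) phi_incr (y + k%:R))}.
  apply: cvg_big => [|k _]; first exact: add_continuous.
  have xk : 0 < x + k%:R by rewrite ltr_wpDr.
  apply: (@continuous_comp _ _ _ (fun y => y + k%:R) phi_incr).
    by apply: continuousD; [exact: cvg_id|exact: cst_continuous].
  exact: is_derive_continuous (phi_incr_derive xk).
have e20 : 0 < e / 2 by rewrite divr_gt0.
move/cvgrPdist_lt : cS => /(_ _ e20) cS.
have n0 : (0 < n)%N by near: n; exists 1%N.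
have nR : 0 < n%:R :> R by rewrite ltr0n.
have ne : n%:R^-1 < e / 2.
  rewrite invf_plt ?posrE//; near: n; exact: nbhs_infty_gtr.
have bnd (z : R) : 0 < z -> - n%:R^-1 <= phi (z + n%:R) <= 0.
  move=> z0; have zn : 0 < z + n%:R by rewrite ltr_wpDr.
  rewrite phi_le0// andbT; apply: le_trans (phi_geNV _) => //.
  by rewrite lerN2 lef_pV2 ?posrE// lerDr ltW.
near=> y.
have y0 : 0 < y by near: y; exact: lt_nbhsr.
have : `|\sum_(k < n) phi_incr (x + k%:R) -
    \sum_(k < n) phi_incr (y + k%:R)| < e / 2.
  by near: y.
rewrite (phi_series n x0) (phi_series n y0).
have /andP[h1 h2] := bnd _ x0; have /andP[h3 h4] := bnd _ y0.
rewrite !ltr_norml => /andP[h5 h6].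
by apply/andP; split; lra.
Unshelve. all: by end_near. Qed.

End digamma_function.

(** * Positive definite matrices *)

Section spd_matrices.
Context {R : realType}.

Lemma quadE d (A : 'M[R]_d) (v : 'cV[R]_d) :
  (v^T *m A *m v) ord0 ord0 = \tr (A *m (v *m v^T)).
Proof. by rewrite -trace_mx11 -mulmxA mxtrace_mulC -mulmxA. Qed.

Lemma quad1E d (v : 'cV[R]_d) : (v^T *m v) ord0 ord0 = \sum_i v i ord0 ^+ 2.
Proof. by rewrite mxE; apply: eq_bigr => i _; rewrite mxE expr2. Qed.

Lemma quad1_ge0 d (v : 'cV[R]_d) : 0 <= (v^T *m v) ord0 ord0.
Proof. by rewrite quad1E sumr_ge0// => i _; exact: sqr_ge0. Qed.

Lemma quad1_gt0 d (v : 'cV[R]_d) : v != 0 -> 0 < (v^T *m v) ord0 ord0.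
Proof.
move=> v0; rewrite lt_neqAle quad1_ge0 andbT eq_sym; apply: contra v0.
rewrite quad1E psumr_eq0 => [/allP h|i _]; last exact: sqr_ge0.
apply/eqP/matrixP => i j; rewrite (ord1 j) mxE; apply/eqP.
by have := h i; rewrite mem_index_enum sqrf_eq0; apply.
Qed.

Lemma spd_ge0 d (A : 'M[R]_d) (v : 'cV[R]_d) :
  spd A -> 0 <= (v^T *m A *m v) ord0 ord0.
Proof.
case=> _ A0; have [->|/A0/ltW//] := eqVneq v 0.
by rewrite mulmx0 mxE.
Qed.

Lemma spd_conj d (C A : 'M[R]_d) : C \in unitmx -> spd A ->
  spd (C *m A *m C^T).
Proof.
move=> uC [As A0]; split; first by rewrite !trmx_mul trmxK As mulmxA.
move=> v v0; rewrite !mulmxA -[v^T *m C](trmxK) trmx_mul trmxK -mulmxA.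
apply: A0; apply: contra v0 => /eqP h.
have uCT : C^T \in unitmx by rewrite unitmx_tr.
by rewrite -(mulKmx uCT v) h mulmx0.
Qed.

Lemma spd_scale d (c : R) (A : 'M[R]_d) : 0 < c -> spd A -> spd (c *: A).
Proof.
move=> c0 [As A0]; split; first by rewrite linearZ/= As.
by move=> v v0; rewrite -scalemxAr -scalemxAl mxE mulr_gt0// A0.
Qed.

Lemma schur_spd d (P : 'M[R]_(1 + d)) : spd P ->
  let a := P ord0 ord0 in let B := dlsubmx P in
  0 < a /\ spd (drsubmx P - a^-1 *: (B *m B^T)).
Proof.
move=> [Ps P0] a B.
have ulE : ulsubmx P = a%:M.
  rewrite [LHS]mx11_scalar; congr _%:M; rewrite !mxE.
  by congr (P _ _); apply/val_inj.
have urE : ursubmx P = B^T by rewrite /B trmx_dlsub Ps.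
have PE : P = block_mx a%:M B^T B (drsubmx P) by rewrite -ulE -urE submxK.
have a0 : 0 < a.
  have := P0 (col_mx 1%:M 0); rewrite PE tr_col_mx mul_row_block mul_row_col.
  rewrite !trmx1 !mul1mx !trmx0 !mul0mx !addr0 mulmx1 mulmx0 addr0.
  rewrite mxE eqxx mulr1n; apply.
  apply/eqP => /(congr1 usubmx); rewrite col_mxKu linear0.
  by move=> /matrixP/(_ ord0 ord0)/eqP; rewrite !mxE oner_eq0.
split=> //; split.
  rewrite linearB linearZ/= trmx_mul trmxK; congr (_ - _).
  by rewrite trmx_drsub Ps.
(* For given [v] this first coordinate minimises the quadratic form of [P]; the minimum is the form
   of the Schur complement at [v]. *)
move=> v v0; pose u := - a^-1 *: (B^T *m v).
have := P0 (col_mx u v).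
have -> : (col_mx u v)^T *m P *m col_mx u v =
    v^T *m (drsubmx P - a^-1 *: (B *m B^T)) *m v.
  rewrite -mulmxA [in LHS]PE mul_block_col tr_col_mx mul_row_col.
  have -> : a%:M *m u + B^T *m v = 0.
    by rewrite mul_scalar_mx /u scalerA mulrN divff ?gt_eqF// scaleN1r addNr.
  rewrite mulmx0 add0r -[RHS]mulmxA; congr (_ *m _).
  rewrite mulmxBl addrC; congr (_ + _).
  by rewrite /u -scalemxAr scaleNr -scalemxAl mulmxA.
apply; apply: contra v0 => /eqP/(congr1 dsubmx).
by rewrite col_mxKd linear0 => ->.
Qed.

Lemma cholesky d (P : 'M[R]_d) : spd P ->
  exists L : 'M[R]_d, [/\ is_trig_mx L, forall i, 0 < L i i & P = L *m L^T].
Proof.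
elim: d P => [|d ih] P Pspd.
  exists 0; split; [by apply/is_trig_mxP => -[]|by case|].
  by apply/matrixP => -[].
have [a0 Sspd] := @schur_spd d P Pspd.
have [Ps _] := Pspd.
move: a0 Sspd; set a := P ord0 ord0; set B := dlsubmx _ => a0 Sspd.
have [L [Lt L0 LE]] := ih _ Sspd.
have ulE : @ulsubmx _ 1 d 1 d P = a%:M.
  rewrite [LHS]mx11_scalar; congr _%:M; rewrite !mxE.
  by congr (P _ _); apply/val_inj.
have urE : @ursubmx _ 1 d 1 d P = B^T by rewrite /B trmx_dlsub Ps.
have PE : P = block_mx a%:M B^T B (@drsubmx _ 1 d 1 d P).
  by rewrite -ulE -urE submxK.
have r0 : 0 < Num.sqrt a by rewrite sqrtr_gt0.
have rr : Num.sqrt a * Num.sqrt a = a by rewrite -expr2 sqr_sqrtr// ltW.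
(* The first column of the factor is that of [P] divided by the root of its pivot; the induction
   hypothesis factors the Schur complement. *)
exists (block_mx (Num.sqrt a)%:M 0 ((Num.sqrt a)^-1 *: B) L); split.
- by rewrite (@is_trig_block_mx _ 1 d 1 d)// eqxx Lt scalar_mx_is_trig.
- move=> i; case: (splitP (i : 'I_(1 + d))) => j ij.
    have -> : i = lshift d j by apply/val_inj.
    by rewrite [X in 0 < X](@block_mxEul _ 1 d 1 d) (ord1 j) mxE eqxx mulr1n.
  have -> : i = rshift 1 j by apply/val_inj.
  by rewrite [X in 0 < X](@block_mxEdr _ 1 d 1 d).
rewrite [LHS]PE (@tr_block_mx _ 1 d 1 d) (@mulmx_block _ 1 d 1 d 1 d).
rewrite trmx0 !mulmx0 !mul0mx addr0.
rewrite tr_scalar_mx -scalar_mxM rr -LE linearZ/= mul_scalar_mx mul_mx_scalar.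
rewrite !scalerA divff ?mulVf ?gt_eqF// !scale1r !addr0.
by rewrite -scalemxAl -scalemxAr scalerA -invfM rr (addrC (a^-1 *: _)) subrK.
Qed.

Lemma cholesky_unit d (P : 'M[R]_d) : spd P ->
  exists2 C : 'M[R]_d, C \in unitmx & P = C *m C^T.
Proof.
move=> /cholesky[L [Lt L0 LE]]; exists L => //.
rewrite unitmxE det_trig// unitfE; apply/prodf_neq0 => i _.
by rewrite gt_eqF.
Qed.

Lemma spd_det_gt0 d (P : 'M[R]_d) : spd P -> 0 < \det P.
Proof.
move=> /cholesky_unit[C]; rewrite unitmxE unitfE => C0 ->.
by rewrite det_mulmx det_tr -expr2 exprn_even_gt0.
Qed.

Lemma spd_unitmx d (P : 'M[R]_d) : spd P -> P \in unitmx.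
Proof. by move=> /spd_det_gt0 P0; rewrite unitmxE unitfE gt_eqF. Qed.

Lemma spd_inv d (P : 'M[R]_d) : spd P -> spd (invmx P).
Proof.
move=> Pspd; have uP := spd_unitmx Pspd.
have iT : (invmx P)^T = invmx P by rewrite trmx_inv; case: Pspd => ->.
have := @spd_conj _ (invmx P) P; rewrite unitmx_inv => /(_ uP Pspd).
by rewrite mulVmx// mul1mx iT.
Qed.

Lemma ln_prod_gt0 (I : Type) (r : seq I) (F : I -> R) : (forall i, 0 < F i) ->
  0 < \prod_(i <- r) F i /\ ln (\prod_(i <- r) F i) = \sum_(i <- r) ln (F i).
Proof.
move=> F0; elim/big_ind2: _ => [|x1 x2 y1 y2 [x0 <-] [y0 <-]|i _] //.
  by rewrite ln1.
by rewrite mulr_gt0// lnM.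
Qed.

(* With P = L L^T, ln det P = \sum_i ln (L_ii ^ 2) and tr P = \sum_ij L_ij ^ 2,
   so the inequality and its equality case reduce to those of ln t <= t - 1. *)
Lemma ln_det_le_tr d (P : 'M[R]_d) : spd P ->
  ln (\det P) <= \tr P - d%:R /\ (ln (\det P) = \tr P - d%:R -> P = 1%:M).
Proof.
move=> /cholesky[L [Lt L0 PE]].
pose l i := L i i ^+ 2.
have l0 i : 0 < l i by rewrite exprn_gt0.
have detE : ln (\det P) = \sum_i ln (l i).
  rewrite PE det_mulmx det_tr det_trig// -big_split/=.
  by have [_ ->] := ln_prod_gt0 (index_enum _) (fun i => mulr_gt0 (L0 i) (L0 i)).
pose q i := \sum_(j | j != i) L i j ^+ 2.
have q0 i : 0 <= q i by rewrite sumr_ge0// => j _; exact: sqr_ge0.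
have trE : \tr P - d%:R = \sum_i (l i - 1 + q i).
  rewrite -[d in d%:R]card_ord -sumr_const -sumrB; apply: eq_bigr => i _.
  rewrite PE mxE (bigD1 i)//= mxE -expr2 -/(l i) addrAC; congr (_ + _).
  by apply: eq_bigr => j _; rewrite mxE expr2.
have le i : ln (l i) <= l i - 1 + q i by rewrite ler_wpDr// ln_le_subr1.
split; first by rewrite detE trE; exact: ler_sum.
rewrite detE trE => /eqP; rewrite eq_sym -subr_eq0 -sumrB psumr_eq0; last first.
  by move=> i _; rewrite subr_ge0.
move=> /allP h.
have {}h i : ln (l i) = l i - 1 + q i.
  by have := h i; rewrite mem_index_enum subr_eq0 => /(_ isT)/eqP.
have qi0 i : q i = 0.
  by have := h i; have := ln_le_subr1 (l0 i); have := q0 i; lra.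
have li1 i : L i i = 1.
  have := h i; rewrite qi0 addr0 => /(ln_eq_subr1 (l0 i))/eqP.
  by rewrite /l sqrf_eq1 => /orP[/eqP//|/eqP Li]; have := L0 i; rewrite Li; lra.
have L1 : L = 1%:M.
  apply/matrixP => i j; rewrite mxE; have [<-|ij] := eqVneq i j; first exact: li1.
  have := qi0 i; move/eqP; 
  rewrite psumr_eq0 => [/allP/(_ j)|k _]; last exact: sqr_ge0.
  by rewrite mem_index_enum eq_sym ij sqrf_eq0 => /(_ isT)/eqP.
by rewrite PE L1 trmx1 mulmx1.
Qed.

(** Writing S = C C^T reduces this to the case of the identity for P = C^-1 T C^-T, with tr P = tr
    (S^-1 T) and det P = det T / det S. It is the nonnegativity of the relative entropy of centred
    Gaussians, with its equality case. *)
Lemma ln_det_le_tr_inv d (S T : 'M[R]_d) : spd S -> spd T ->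
  ln (\det T) - ln (\det S) <= \tr (invmx S *m T) - d%:R /\
  (ln (\det T) - ln (\det S) = \tr (invmx S *m T) - d%:R -> T = S).
Proof.
move=> Sspd Tspd; have [C uC SE] := cholesky_unit Sspd.
have uC' : C^T \in unitmx by rewrite unitmx_tr.
pose P := invmx C *m T *m (invmx C)^T.
have Pspd : spd P by apply: spd_conj => //; rewrite unitmx_inv.
have iS : invmx S = (invmx C)^T *m invmx C.
  rewrite trmx_inv; apply: (can_inj (mulKmx (spd_unitmx Sspd))).
  rewrite mulmxV ?spd_unitmx// SE -mulmxA (mulmxA C^T) mulmxV// mul1mx.
  by rewrite mulmxV.
have trE : \tr P = \tr (invmx S *m T).
  by rewrite /P mxtrace_mulC iS mulmxA.
have TE : T = C *m P *m C^T.
  by rewrite /P trmx_inv !mulmxA mulmxV// mul1mx -mulmxA mulVmx// mulmx1.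
have detE : ln (\det P) = ln (\det T) - ln (\det S).
  have := spd_det_gt0 Pspd; have := spd_det_gt0 Sspd.
  have -> : \det T = \det S * \det P.
    by rewrite TE SE !det_mulmx; ring.
  by move=> S0 P0; rewrite lnM// addrC addKr.
have [h1 h2] := ln_det_le_tr Pspd.
rewrite -trE -detE; split=> // /h2 P1.
by rewrite TE P1 mulmx1 SE.
Qed.

(** After the change of basis S = C C^T the perturbation is measured against the identity: [K], the
    sum of the absolute entries of [B], bounds its quadratic form. The radius is 1/(K+1) because [K]
    may be 0. *)
Lemma spd_perturb d (S H : 'M[R]_d) : spd S -> H^T = H ->
  exists2 e : R, 0 < e & forall t, `|t| < e -> spd (t *: H + S).
Proof.
move=> Sspd HH; have [C uC SE] := cholesky_unit Sspd.
have uC' : C^T \in unitmx by rewrite unitmx_tr.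
pose B := invmx C *m H *m (invmx C)^T.
have HE : H = C *m B *m C^T.
  by rewrite /B trmx_inv !mulmxA mulmxV// mul1mx -mulmxA mulVmx// mulmx1.
pose K := \sum_i \sum_j `|B i j|.
have K0 : 0 <= K by rewrite !sumr_ge0// => i _; rewrite sumr_ge0.
have bnd (y : 'cV[R]_d) : 
    `|(y^T *m B *m y) ord0 ord0| <= K * (y^T *m y) ord0 ord0.
  rewrite quad1E -mulmxA mxE; apply: (le_trans (ler_norm_sum _ _ _)).
  rewrite mulr_suml ler_sum// => i _; rewrite !mxE normrM mulrC.
  apply: (@le_trans _ _ ((\sum_j `|B i j| * `|y j ord0|) * `|y i ord0|)).
    rewrite ler_wpM2r//; apply: (le_trans (ler_norm_sum _ _ _)).
    by apply: ler_sum => j _; rewrite normrM.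
  rewrite !mulr_suml ler_sum// => j _; rewrite -mulrA ler_wpM2l//.
  have yk k : y k ord0 ^+ 2 <= \sum_i y i ord0 ^+ 2.
    by rewrite (bigD1 k)//= lerDl sumr_ge0// => l _; exact: sqr_ge0.
  have := yk i; have := yk j; rewrite -!(real_normK (num_real (y _ _))) => h1 h2.
  have : 0 <= (`|y i ord0| - `|y j ord0|) ^+ 2 by exact: sqr_ge0.
  by nra.
exists (K + 1)^-1; first by rewrite invr_gt0 ltr_wpDl.
move=> t te; split.
  by rewrite linearD linearZ/= HH; case: Sspd => ->.
move=> v v0; pose y := C^T *m v.
have y0 : y != 0.
  by apply: contra v0 => /eqP h; rewrite -(mulKmx uC' v) -/y h mulmx0.
have -> : v^T *m (t *: H + S) *m v = t *: (y^T *m B *m y) + y^T *m y.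
  rewrite mulmxDr mulmxDl -scalemxAr -scalemxAl; congr (_ *: _ + _).
    by rewrite HE /y trmx_mul trmxK !mulmxA.
  by rewrite SE /y trmx_mul trmxK !mulmxA.
rewrite mxE mxE; have yy := quad1_gt0 y0; have := bnd y.
set Q := (y^T *m B *m y) _ _; set q := (y^T *m y) _ _ => Qq.
have tQ : `|t * Q| <= `|t| * (K * q) by rewrite normrM ler_wpM2l.
have tK : `|t| * (K + 1) < 1.
  by rewrite -ltr_pdivlMr ?div1r// ltr_wpDl.
have : - (t * Q) <= `|t * Q| by rewrite -normrN ler_norm.
have : `|t| * K * q < q.
  rewrite -[ltRHS]mul1r ltr_pM2r//; apply: le_lt_trans tK.
  by rewrite ler_wpM2l// lerDl.
by lra.
Qed.

End spd_matrices.

(** * Descent of the objective *)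

Section weighted_scatter.
Context {R : realType} {d n : nat}.
Variable x : 'I_n -> 'cV[R]_d.
Implicit Types (c : 'I_n -> R).

(** The weights are arbitrary and not normalised, so that the updates of different states are
    instances that can be compared. *)
Definition wmean c : 'cV[R]_d := (\sum_i c i)^-1 *: \sum_i c i *: x i.

Definition wscatter c (m : 'cV[R]_d) : 'M[R]_d :=
  \sum_i c i *: ((x i - m) *m (x i - m)^T).

Definition wcov c : 'M[R]_d := (\sum_i c i)^-1 *: wscatter c (wmean c).

Lemma wmean_centered c (m : 'cV[R]_d) : \sum_i c i != 0 ->
  \sum_i c i *: (x i - m) = (\sum_i c i) *: (wmean c - m).
Proof.
move=> s0; under eq_bigr do rewrite scalerBr.
by rewrite sumrB -scaler_suml scalerBr /wmean scalerA divff// scale1r.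
Qed.

(** The parallel axis identity: the mixed terms vanish because the deviations from the weighted mean
    sum to zero. *)
Lemma wscatter_shift c (m : 'cV[R]_d) : \sum_i c i != 0 ->
  wscatter c m =
  (\sum_i c i) *: (wcov c + (wmean c - m) *m (wmean c - m)^T).
Proof.
move=> s0; rewrite scalerDr /wcov scalerA divff// scale1r.
set u := wmean c - m.
have z0 : \sum_i c i *: (x i - wmean c) = 0.
  by rewrite wmean_centered// subrr scaler0.
have xE i : x i - m = (x i - wmean c) + u by rewrite /u addrA subrK.
rewrite /wscatter.
under eq_bigr => i _.
  rewrite xE linearD/= mulmxDl !mulmxDr !scalerDr.
  rewrite (scalemxAl _ _ u^T) (scalemxAr _ u).
  over.
rewrite !big_split/= -mulmx_suml z0 mul0mx addr0 -mulmx_sumr.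
have -> : \sum_i c i *: (x i - wmean c)^T = 0.
  rewrite -[RHS](trmx0 R d 1) -z0 raddf_sum/=.
  by apply: eq_bigr => i _; rewrite [RHS]linearZ.
by rewrite mulmx0 add0r -scaler_suml.
Qed.

Lemma sum_delta_trace c (m : 'cV[R]_d) (T : 'M[R]_d) :
  \sum_i c i * delta x m T i = \tr (invmx T *m wscatter c m).
Proof.
rewrite /wscatter mulmx_sumr raddf_sum/=; apply: eq_bigr => i _.
by rewrite -scalemxAr linearZ/= /delta quadE.
Qed.

Lemma sum_delta c (m : 'cV[R]_d) (T : 'M[R]_d) : \sum_i c i != 0 ->
  \sum_i c i * delta x m T i = (\sum_i c i) *
  (\tr (invmx T *m wcov c) +
   ((wmean c - m)^T *m invmx T *m (wmean c - m)) ord0 ord0).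
Proof.
move=> s0; rewrite sum_delta_trace wscatter_shift// -scalemxAr linearZ/=.
by rewrite mulmxDr linearD/= quadE.
Qed.

Lemma quad_wcov c (v : 'cV[R]_d) :
  (v^T *m wcov c *m v) ord0 ord0 =
  (\sum_i c i)^-1 * \sum_i c i * (v^T *m (x i - wmean c)) ord0 ord0 ^+ 2.
Proof.
rewrite /wcov -scalemxAr -scalemxAl mxE; congr (_ * _).
rewrite /wscatter mulmx_sumr mulmx_suml summxE; apply: eq_bigr => i _.
rewrite -scalemxAr -scalemxAl mxE; congr (_ * _).
rewrite (mulmxA v^T) -[_ *m _ *m v]mulmxA mxE big_ord1 expr2; congr (_ * _).
by rewrite -[in RHS]trace_mx11 -mxtrace_tr trmx_mul trmxK trace_mx11.
Qed.

Lemma wcov_sym c : (wcov c)^T = wcov c.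
Proof.
rewrite /wcov linearZ/= /wscatter raddf_sum/=; congr (_ *: _).
by apply: eq_bigr => i _; rewrite linearZ/= trmx_mul trmxK.
Qed.

(* Both conditions say that the points do not lie on a common hyperplane. *)
Lemma spd_wcov c c' : (forall i, 0 < c i) -> (forall i, 0 < c' i) ->
  0 < \sum_i c i -> 0 < \sum_i c' i -> spd (wcov c) -> spd (wcov c').
Proof.
move=> c0 c'0 s0 s'0 [_ pos]; split; first exact: wcov_sym.
move=> v v0; have := pos _ v0; rewrite !quad_wcov !pmulr_rgt0 ?invr_gt0// => h.
rewrite lt_neqAle sumr_ge0 ?andbT; last first.
  by move=> i _; rewrite mulr_ge0 ?sqr_ge0// ltW.
apply: contraTN h; rewrite eq_sym psumr_eq0 => [/allP a|i _]; last first.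
  by rewrite mulr_ge0 ?sqr_ge0// ltW.
have {}a i : v^T *m (x i - wmean c') = 0.
  have := a i; rewrite mem_index_enum mulf_eq0 gt_eqF//= sqrf_eq0.
  move=> /(_ isT)/eqP h.
  by apply/matrixP => k l; rewrite (ord1 k) (ord1 l) h mxE.
have mm : v^T *m (wmean c - wmean c') = 0.
  have := wmean_centered (wmean c') (lt0r_neq0 s0) => /(congr1 (mulmx v^T)).
  rewrite mulmx_sumr big1 => [/esym/eqP|i _]; last first.
    by rewrite -scalemxAr a scaler0.
  by rewrite -scalemxAr scaler_eq0 gt_eqF//= => /eqP.
rewrite -leNgt big1// => i _.
have -> : x i - wmean c = (x i - wmean c') - (wmean c - wmean c').
  by rewrite opprB addrA subrK.
by rewrite mulmxBr a mm subr0 mxE expr0n mulr0.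
Qed.

End weighted_scatter.

Section student_t_objective.
Context {R : realType} {d n : nat}.
Variables (x : 'I_n -> 'cV[R]_d) (w : 'I_n -> R).
Hypotheses (hw : forall i, 0 < w i) (hw1 : \sum_(i < n) w i = 1).
Implicit Types (nu : R) (mu m : 'cV[R]_d) (S T : 'M[R]_d).

Definition em_weight nu mu S i := w i * gamma_weight x nu mu S i.

Lemma mu_updateE nu mu S :
  mu_update x w (nu, mu, S) = wmean x (em_weight nu mu S).
Proof. by []. Qed.

Lemma Sigma_updateE nu mu S :
  Sigma_update x w (nu, mu, S) = wcov x (em_weight nu mu S).
Proof. by []. Qed.

Lemma delta_ge0 mu S i : spd S -> 0 <= delta x mu S i.
Proof. by move=> /spd_inv iS; exact: spd_ge0. Qed.

Lemma nu_delta_gt0 nu mu S i : 0 < nu -> spd S -> 0 < nu + delta x mu S i.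
Proof. by move=> nu0 /delta_ge0 h; rewrite ltr_wpDr. Qed.

Lemma gamma_weight_gt0 nu mu S i : 0 < nu -> spd S ->
  0 < gamma_weight x nu mu S i.
Proof. by move=> nu0 Ss; rewrite divr_gt0 ?nu_delta_gt0// ltr_wpDr. Qed.

Lemma em_weight_gt0 nu mu S i : 0 < nu -> spd S -> 0 < em_weight nu mu S i.
Proof. by move=> nu0 Ss; rewrite mulr_gt0// gamma_weight_gt0. Qed.

(** The index set is nonempty because the [w i] sum to 1. *)
Lemma sum_gt0 (c : 'I_n -> R) : (forall i, 0 < c i) -> 0 < \sum_i c i.
Proof.
move=> c0; rewrite lt_neqAle sumr_ge0 ?andbT => [|i _]; last exact: ltW.
apply/eqP => /esym/eqP; rewrite psumr_eq0 => [/allP h|i _]; last exact: ltW.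
move/eqP: hw1; rewrite big1 ?(eq_sym 0) ?oner_eq0// => i _.
by have := h i; rewrite mem_index_enum gt_eqF// => /(_ isT).
Qed.

Lemma sum_em_weight_gt0 nu mu S : 0 < nu -> spd S ->
  0 < \sum_i em_weight nu mu S i.
Proof. by move=> nu0 Ss; apply: sum_gt0 => i; exact: em_weight_gt0. Qed.

Lemma sum_em_weight nu mu S : 0 < nu -> spd S ->
  \sum_i em_weight nu mu S i * (nu + delta x mu S i) = nu + d%:R.
Proof.
move=> nu0 Ss; transitivity ((\sum_i w i) * (nu + d%:R)).
  rewrite mulr_suml; apply: eq_bigr => i _.
  rewrite /em_weight /gamma_weight -!mulrA mulVf ?mulr1//.
  by rewrite gt_eqF// nu_delta_gt0.
by rewrite hw1 mul1r.
Qed.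

Lemma objectiveB nu mu S m T :
  objective x w nu m T - objective x w nu mu S =
  (d%:R + nu) * (\sum_i w i *
    (ln (nu + delta x m T i) - ln (nu + delta x mu S i)))
  + (ln (\det T) - ln (\det S)).
Proof.
rewrite /objective; under [in RHS]eq_bigr do rewrite mulrBr.
rewrite sumrB; move: (\sum_i _) (\sum_i _) (ln (\det _)) => a b e.
by move: (ln (\det _)) (ln (Gamma _)) (ln (Gamma _)) => ? ? ?; ring.
Qed.

Lemma objective_em_step nu mu S : 0 < nu -> spd S ->
  let mu' := mu_update x w (nu, mu, S) in
  let S' := Sigma_update x w (nu, mu, S) in
  spd S' ->
  objective x w nu mu' S' <= objective x w nu mu S /\
  (objective x w nu mu' S' = objective x w nu mu S ->
   [/\ mu' = mu, S' = S & \sum_i em_weight nu mu S i = 1]).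
Proof.
move=> nu0 Ss mu' S' S's; set c := em_weight nu mu S.
set s := \sum_i c i.
have s0 : 0 < s by exact: sum_em_weight_gt0.
have sN0 : s != 0 by rewrite gt_eqF.
have nud0 : 0 < nu + d%:R by rewrite ltr_wpDr.
set tau := \tr (invmx S *m S').
set q := ((mu' - mu)^T *m invmx S *m (mu' - mu)) ord0 ord0.
have q0 : 0 <= q by apply: spd_ge0; exact: spd_inv.
have old : s * nu + s * (tau + q) = nu + d%:R.
  rewrite -(sum_em_weight mu nu0 Ss) -sum_delta// mulr_suml -big_split/=.
  by apply: eq_bigr => i _; rewrite mulrDr.
have new : \sum_i c i * (nu + delta x mu' S' i) = s * (nu + d%:R).
  under eq_bigr do rewrite mulrDr.
  rewrite big_split/= -mulr_suml sum_delta// -/mu' -/S'.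
  rewrite mulVmx ?spd_unitmx// mxtrace1 subrr trmx0 !mul0mx mxE addr0.
  by rewrite mulrDr.
have jensen : \sum_i w i *
    (ln (nu + delta x mu' S' i) - ln (nu + delta x mu S i))
    <= ln s.
  have lnsE : ln s = \sum_i w i * ln s by rewrite -mulr_suml hw1 mul1r.
  rewrite -subr_le0 lnsE -sumrB.
  (* The factor s in the denominator gives these ratios the weighted mean 1, so the bounds ln t <= t
     - 1 add up to 0. *)
  have tE : \sum_i w i * ((nu + delta x mu' S' i) /
      (s * (nu + delta x mu S i)) - 1) = 0.
    under eq_bigr do rewrite mulrBr mulr1.
    rewrite sumrB hw1.
    have -> : \sum_i w i *
          ((nu + delta x mu' S' i) / (s * (nu + delta x mu S i)))
        = (s * (nu + d%:R))^-1 * \sum_i c i * (nu + delta x mu' S' i).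
      rewrite mulr_sumr; apply: eq_bigr => i _.
      rewrite /c /em_weight /gamma_weight.
      have := nu_delta_gt0 mu i nu0 Ss => h.
      by field; rewrite sN0 !gt_eqF.
    by rewrite new mulVf ?subrr// mulf_neq0// gt_eqF.
  rewrite -[leRHS]tE.
  apply: ler_sum => i _; rewrite -mulrBr ler_wpM2l ?(ltW (hw i))//.
  have h1 := nu_delta_gt0 mu i nu0 Ss; have h2 := nu_delta_gt0 mu' i nu0 S's.
  rewrite -addrA -opprD -lnM ?posrE// -ln_div ?posrE ?mulr_gt0//.
  by rewrite [_ * s]mulrC ln_le_subr1// divr_gt0// mulr_gt0.
(* Scaling [S'] by s makes the trace equal to s tau, the quantity that [old] controls. *)
have [det_le det_eq] := ln_det_le_tr_inv Ss (spd_scale s0 S's).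
have trE : \tr (invmx S *m (s *: S')) = s * tau by rewrite -scalemxAr linearZ.
have detE : ln (\det (s *: S')) = d%:R * ln s + ln (\det S').
  rewrite detZ lnM ?posrE ?exprn_gt0 ?spd_det_gt0// lnXn//.
  by rewrite mulr_natl.
rewrite trE detE in det_le det_eq.
have lns := ln_le_subr1 s0.
have h1 : (d%:R + nu) * (\sum_i w i *
    (ln (nu + delta x mu' S' i) - ln (nu + delta x mu S i))) <= (d%:R + nu) * ln s.
  by rewrite ler_wpM2l// addr_ge0// ltW.
have h2 : nu * ln s <= nu * (s - 1) by rewrite ler_wpM2l// ltW.
have sq : 0 <= s * q by rewrite mulr_ge0// ltW.
have DE := objectiveB nu mu S mu' S'.
move: h1 DE det_le det_eq; set J := (d%:R + nu) * (\sum_i _).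
set l' := ln (\det S'); set l := ln (\det S); set ls := ln s.
rewrite -/ls in h2 lns => h1 DE det_le det_eq.
(* The bounds add up to nu ln s + s tau - d <= nu (s - 1) + s tau - d, which is -s q by [old]. No
   increase of L is thus possible, and equality makes every bound used an equality and q zero. *)
split; first by rewrite -subr_le0 DE; lra.
move=> /eqP; rewrite -subr_eq0 DE => /eqP D0.
have sq0 : s * q = 0 by lra.
have lE : nu * (ls - (s - 1)) = 0 by lra.
have s1 : s = 1.
  apply: ln_eq_subr1 => //; move/eqP: lE; rewrite mulf_eq0 gt_eqF//= subr_eq0.
  by move/eqP.
have SE : S' = S.
  have : s *: S' = S by apply: det_eq; lra.
  by rewrite s1 scale1r.
split=> //.
apply/eqP; rewrite -subr_eq0; apply: contraT => h.
have [_ /(_ _ h)] := spd_inv Ss.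
by move/eqP: sq0; rewrite mulf_eq0 (negbTE sN0)/= -/q => /eqP->; rewrite ltxx.
Qed.

(** The part of L depending on [m] and [T], with each logarithm of [nu + delta] replaced by its
    tangent at the current parameters, up to an additive constant. The slopes are the EM weights. *)
Definition em_surrogate nu mu S m T :=
  \sum_i em_weight nu mu S i * delta x m T i + ln (\det T).

(** The logarithm lies below its tangents, so L minus the surrogate is largest at the point of
    tangency. *)
Lemma objective_le_surrogate nu mu S m T : 0 < nu -> spd S -> spd T ->
  objective x w nu m T - em_surrogate nu mu S m T <=
  objective x w nu mu S - em_surrogate nu mu S mu S.
Proof.
move=> nu0 Ss Ts; rewrite -subr_ge0.
rewrite (_ : _ - _ = (em_surrogate nu mu S m T - em_surrogate nu mu S mu S) -
  (objective x w nu m T - objective x w nu mu S)); last by ring.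
rewrite objectiveB /em_surrogate.
rewrite (_ : _ - _ = (\sum_i em_weight nu mu S i * delta x m T i -
  \sum_i em_weight nu mu S i * delta x mu S i) - (d%:R + nu) *
  \sum_i w i * (ln (nu + delta x m T i) - ln (nu + delta x mu S i)));
  last by move: (\sum_i _ ) (\sum_i _) (\sum_i _); intros; ring.
rewrite -sumrB mulr_sumr -sumrB sumr_ge0// => i _.
have h1 := nu_delta_gt0 mu i nu0 Ss; have h2 := nu_delta_gt0 m i nu0 Ts.
have nud0 : 0 < nu + d%:R by rewrite ltr_wpDr.
rewrite -mulrBr (_ : _ - _ = (nu + d%:R) * (w i *
  ((nu + delta x m T i) / (nu + delta x mu S i) - 1 -
   (ln (nu + delta x m T i) - ln (nu + delta x mu S i))))); last first.
  by rewrite /em_weight /gamma_weight; field; rewrite gt_eqF.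
rewrite mulr_ge0 ?(ltW nud0)// mulr_ge0 ?(ltW (hw i))//.
by rewrite subr_ge0 -ln_div ?posrE// ln_le_subr1// divr_gt0.
Qed.

(** At a fixed point with total weight 1 the surrogate is tr (T^-1 S) + ln det T plus a nonnegative
    form in mu - m; the trace inequality applies with [S] and [T] exchanged. *)
Lemma surrogate_min nu mu S m T : 0 < nu -> spd S -> spd T ->
  mu_update x w (nu, mu, S) = mu -> Sigma_update x w (nu, mu, S) = S ->
  \sum_i em_weight nu mu S i = 1 ->
  em_surrogate nu mu S mu S <= em_surrogate nu mu S m T.
Proof.
move=> nu0 Ss Ts muE SE s1; rewrite /em_surrogate.
rewrite !sum_delta ?s1 ?oner_neq0// -mu_updateE -Sigma_updateE muE SE !mul1r.
rewrite mulVmx ?spd_unitmx// mxtrace1 subrr trmx0 !mul0mx mxE addr0.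
have [h _] := ln_det_le_tr_inv Ts Ss.
have := spd_ge0 (mu - m) (spd_inv Ts).
by lra.
Qed.

(** Each weight moves towards 1 as nu grows, and t - ln t is smallest at 1. The tangent of t - ln t
    at g' turns this into a square times nu' - nu. It allows b, computed at the old nu, to be
    compared with dL/dnu elsewhere. *)
Lemma b_coef_nonincr mu S nu nu' : 0 < nu -> nu <= nu' -> spd S ->
  b_coef x w nu' mu S <= b_coef x w nu mu S.
Proof.
move=> nu0 nn Ss; have nu'0 := lt_le_trans nu0 nn.
apply: ler_sum => i _; rewrite ler_wpM2l ?(ltW (hw i))// lerB// -subr_ge0.
set g := gamma_weight x nu mu S i; set g' := gamma_weight x nu' mu S i.
have g0 : 0 < g by exact: gamma_weight_gt0.
have g'0 : 0 < g' by exact: gamma_weight_gt0.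
have h : (g - g') * (1 - g'^-1) <= g - ln g - (g' - ln g').
  have := ln_le_subr1 (divr_gt0 g0 g'0); rewrite ln_div ?posrE//.
  rewrite (_ : (g - g') * (1 - g'^-1) = g - g' - (g / g' - 1)); last first.
    by field; rewrite gt_eqF.
  by lra.
apply: le_trans h.
have d1 := nu_delta_gt0 mu i nu0 Ss; have d2 := nu_delta_gt0 mu i nu'0 Ss.
have nd : 0 < nu' + d%:R by rewrite ltr_wpDr.
rewrite (_ : (g - g') * _ = (d%:R - delta x mu S i) ^+ 2 * (nu' - nu) /
  ((nu + delta x mu S i) * (nu' + delta x mu S i) * (nu' + d%:R))).
  have p : 0 < (nu + delta x mu S i) * (nu' + delta x mu S i) * (nu' + d%:R).
    by rewrite !mulr_gt0.
  by rewrite divr_ge0 ?(ltW p)// mulr_ge0 ?sqr_ge0// subr_ge0.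
by rewrite /g /g' /gamma_weight; field; rewrite !gt_eqF.
Qed.

Definition nu_grad nu mu S : R :=
  phi (nu / 2) - phi ((nu + d%:R) / 2) + b_coef x w nu mu S.

Lemma objective_derive_nu nu mu S : 0 < nu -> spd S ->
  is_derive nu 1 (fun t => objective x w t mu S) (nu_grad nu mu S).
Proof.
move=> nu0 Ss; rewrite /objective.
have nud0 : 0 < d%:R + nu by rewrite ltr_wpDl.
have g1 : 0 < (d%:R + nu) / 2 by rewrite divr_gt0.
have g2 : 0 < nu / 2 by rewrite divr_gt0.
have da : is_derive nu 1 (fun t : R => (d%:R + t) / 2) (1 / 2).
  by apply: is_derive_eq; rewrite /GRing.scale/=; ring.
have db : is_derive nu 1 (fun t : R => t / 2) (1 / 2).
  by apply: is_derive_eq; rewrite /GRing.scale/=; ring.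
have d1 := @is_derive1_comp _ _ (fun t : R => (d%:R + t) / 2) _ _ _
  (lnGamma_derive g1) da.
have d2 := @is_derive1_comp _ _ (fun t : R => t / 2) _ _ _
  (lnGamma_derive g2) db.
have d3 := is_derive1_ln nu0.
have d4 i : is_derive nu 1 (fun t => w i * ln (t + delta x mu S i))
    (w i * (nu + delta x mu S i)^-1).
  have p := nu_delta_gt0 mu i nu0 Ss.
  have dc : is_derive nu 1 (fun t : R => t + delta x mu S i) 1.
    by apply: is_derive_eq; rewrite addr0.
  have := @is_derive1_comp _ _ (fun t : R => t + delta x mu S i) _ _ _
    (is_derive1_ln p) dc; rewrite mulr1 => de.
  by apply: is_derive_eq.
have d5 : is_derive nu 1 (fun t => \sum_i w i * ln (t + delta x mu S i))
    (\sum_i w i * (nu + delta x mu S i)^-1).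
  have := is_derive_sum d4.
  by rewrite fct_sumE.
have dall (f1 f2 f3 : R -> R) (a1 a2 a3 : R) : is_derive nu 1 f1 a1 ->
    is_derive nu 1 f2 a2 -> is_derive nu 1 f3 a3 ->
    is_derive nu 1 (fun t => - 2 * f1 t + 2 * f2 t - t * ln t +
      (d%:R + t) * f3 t + ln (\det S))
    (- 2 * a1 + 2 * a2 - (ln nu + nu * nu^-1) + (f3 nu + (d%:R + nu) * a3)).
  move=> e1 e2 e3; apply: is_derive_eq; rewrite /GRing.scale/=; ring.
apply: is_derive_eq (dall _ _ _ _ _ _ d1 d2 d5) _.
have bE : b_coef x w nu mu S =
    (nu + d%:R) * (\sum_i w i * (nu + delta x mu S i)^-1)
    + \sum_i w i * ln (nu + delta x mu S i) - ln (nu + d%:R) - 1.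
  (* Constants become weighted sums, so the identity can be checked for each index. *)
  have cst (c : R) : c = \sum_i w i * c by rewrite -mulr_suml hw1 mul1r.
  rewrite mulr_sumr [ln (nu + d%:R)]cst [X in _ = _ - X]cst.
  rewrite -big_split -!sumrB; apply: eq_bigr => i _ /=.
  rewrite /gamma_weight ln_div ?posrE ?nu_delta_gt0 ?ltr_wpDr//.
  by ring.
have nd : 0 < nu + d%:R by rewrite addrC.
rewrite /nu_grad bE /phi (addrC d%:R) mulfV ?gt_eqF//.
rewrite !ln_div ?posrE//.
move: (\sum_i _) (\sum_i _) => A B.
by field.
Qed.

End student_t_objective.

(** * Differentiability of the objective *)

Section differentiability.
Context {R : realType} {V : normedModType R}.
Implicit Types (f g : V -> R) (a v : V).

Lemma near_eq_differentiable f g a : (\forall v \near a, f v = g v) ->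
  differentiable f a -> differentiable g a.
Proof.
move=> fg df; have fga : f a = g a by exact: nbhs_singleton fg.
have [dc de] := (diff_locallyP _ _).1 df.
have ge : g \o shift a = cst (g a) + 'd f a +o_ 0 id.
  apply/eqaddoP => e e0; move/eqaddoP : de => /(_ e e0) de.
  have {}fg : \forall v \near 0, f (v + a) = g (v + a).
    have : (shift a v) @[v --> 0] --> a.
      rewrite -[X in _ --> X]add0r.
      by apply: cvgD; [exact: cvg_id|exact: cvg_cst].
    by move=> /(_ _ fg).
  near=> v; have : `|(f \o shift a - (cst (f a) + 'd f a)) v| <= e * `|id v|.
    by near: v.
  rewrite !fctE/= fga (_ : f (v + a) = g (v + a))//; near: v; exact: fg.
apply/diff_locallyP.
by rewrite (diff_unique dc ge).
Unshelve. all: by end_near. Qed.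

Lemma differentiable_sumr (I : Type) (r : seq I) (P : pred I) (f : I -> V -> R) a :
  (forall i, P i -> differentiable (f i) a) ->
  differentiable (fun v => \sum_(i <- r | P i) f i v) a.
Proof.
move=> df; elim: r => [|i r ih].
  under eq_fun do rewrite big_nil.
  exact: differentiable_cst.
under eq_fun do rewrite big_cons.
case: (P i) (df i) => [dfi|_] //.
by apply: differentiableD => //; exact: dfi.
Qed.

Lemma differentiable_prodr (I : Type) (r : seq I) (P : pred I) (f : I -> V -> R) a :
  (forall i, P i -> differentiable (f i) a) ->
  differentiable (fun v => \prod_(i <- r | P i) f i v) a.
Proof.
move=> df; elim: r => [|i r ih].
  under eq_fun do rewrite big_nil.
  exact: differentiable_cst.
under eq_fun do rewrite big_cons.
case: (P i) (df i) => [dfi|_] //.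
by apply: differentiableM => //; exact: dfi.
Qed.

Lemma differentiableMr f g a : differentiable f a -> differentiable g a ->
  differentiable (fun v => f v * g v) a.
Proof. exact: differentiableM. Qed.

Lemma differentiableDr f g a : differentiable f a -> differentiable g a ->
  differentiable (fun v => f v + g v) a.
Proof. exact: differentiableD. Qed.

Lemma differentiableBr f g a : differentiable f a -> differentiable g a ->
  differentiable (fun v => f v - g v) a.
Proof. exact: differentiableB. Qed.

Lemma differentiableVr f a : f a != 0 -> differentiable f a ->
  differentiable (fun v => (f v)^-1) a.
Proof. by move=> f0 df; apply: differentiableV. Qed.

Lemma is_derive_differentiable_comp (h : R -> R) f a dh :
  is_derive (f a) 1 h dh -> differentiable f a ->
  differentiable (fun v => h (f v)) a.
Proof.
move=> [dh1 _] df; apply: (@differentiable_comp _ _ _ _ f h) => //.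
exact/derivable1_diffP.
Qed.

Lemma differentiable_ln f a : 0 < f a -> differentiable f a ->
  differentiable (fun v => ln (f v)) a.
Proof. by move=> f0; exact: is_derive_differentiable_comp (is_derive1_ln f0). Qed.

Lemma differentiable_det k (f : V -> 'M[R]_k) a :
  (forall i j, differentiable (fun v => f v i j) a) ->
  differentiable (fun v => \det (f v)) a.
Proof.
move=> df; apply: differentiable_sumr => s _; apply: differentiableMr.
  exact: differentiable_cst.
by apply: differentiable_prodr.
Qed.

Lemma differentiable_cofactor k (f : V -> 'M[R]_k) a (i j : 'I_k) :
  (forall i j, differentiable (fun v => f v i j) a) ->
  differentiable (fun v => cofactor (f v) i j) a.
Proof.
move=> df; apply: differentiableMr; first exact: differentiable_cst.
apply: differentiable_det => i' j'.
under eq_fun do rewrite !mxE.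
exact: df.
Qed.

(** The adjugate formula holds where the determinant is nonzero, hence near [a]; elsewhere [invmx]
    returns its argument. *)
Lemma differentiable_invmx k (f : V -> 'M[R]_k) a (i j : 'I_k) :
  (forall i j, differentiable (fun v => f v i j) a) -> \det (f a) != 0 ->
  differentiable (fun v => invmx (f v) i j) a.
Proof.
move=> df u; have dd := differentiable_det df.
apply: (@near_eq_differentiable (fun v => (\det (f v))^-1 * cofactor (f v) j i)).
  have : \forall v \near a, \det (f v) != 0.
    exact: (differentiable_continuous dd (open_nbhs_nbhs (conj (@open_neq R 0) u))).
  apply: filterS => v fv0.
  by rewrite /invmx unitmxE unitfE fv0 !mxE.
apply: differentiableMr; first exact: differentiableVr.
exact: differentiable_cofactor.
Qed.

(** Maximality is asked only along the line through [a], since positive definite matrices are open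
    only in symmetric directions. *)
Lemma diff_at_max f a v : differentiable f a ->
  (\forall t \near 0, f (t *: v + a) <= f a) -> 'd f a v = 0.
Proof.
move=> df fmax; rewrite -deriveE//.
have dv : derivable f a v by exact: diff_derivable.
have cv : (fun h => h^-1 *: (f (h *: v + a) - f a)) @ 0^' --> 'D_v f a.
  exact: dv.
have fr : \forall t \near 0^'+, f (t *: v + a) <= f a.
  exact: cvg_within fmax.
have fl : \forall t \near 0^'-, f (t *: v + a) <= f a.
  exact: cvg_within fmax.
apply/eqP; rewrite eq_le; apply/andP; split.
  apply: (cvgr_to_le (cvg_dnbhs_at_right cv)); near=> t.
  apply: mulr_ge0_le0; first by rewrite invr_ge0 ltW.
  by rewrite subr_le0; near: t.
apply: (cvgr_to_ge (cvg_dnbhs_at_left cv)); near=> t.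
apply: mulr_le0; first by rewrite invr_le0 ltW.
by rewrite subr_le0; near: t.
Unshelve. all: by end_near. Qed.

(* f - u and - u are both maximal at a, hence stationary. *)
Lemma diff_tangent_majorant f u a v : differentiable f a -> differentiable u a ->
  (\forall t \near 0, f (t *: v + a) - u (t *: v + a) <= f a - u a) ->
  (\forall t \near 0, u a <= u (t *: v + a)) -> 'd f a v = 0.
Proof.
move=> df du fu umin.
have h1 : 'd (f - u) a v = 0.
  by apply: diff_at_max fu; exact: differentiableB.
have h2 : 'd (- u) a v = 0.
  apply: diff_at_max; first exact: differentiableN.
  by apply: filterS umin => t ut; rewrite !fctE lerN2.
have -> : f = (f - u) - (- u) by rewrite opprK subrK.
rewrite diffB; [|exact: differentiableB|exact: differentiableN].
by rewrite /= h1 h2 subr0.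
Qed.

End differentiability.

(** * Differentiability along any parametrised state, for one argument varying or all of them *)

Section student_t_differentiability.
Context {R : realType} {V : normedModType R} {d n : nat}.
Variables (x : 'I_n -> 'cV[R]_d) (w : 'I_n -> R).
Hypotheses (hw : forall i, 0 < w i) (hw1 : \sum_(i < n) w i = 1).
Variables (nu : V -> R) (mu : V -> 'cV[R]_d) (S : V -> 'M[R]_d) (a : V).
Hypotheses (dnu : differentiable nu a)
  (dmu : forall i j, differentiable (fun v => mu v i j) a)
  (dS : forall i j, differentiable (fun v => S v i j) a)
  (nu0 : 0 < nu a) (Ss : spd (S a)).

Lemma differentiable_delta i : differentiable (fun v => delta x (mu v) (S v) i) a.
Proof.
rewrite /delta; under eq_fun do rewrite mxE.
apply: differentiable_sumr => k _; apply: differentiableMr; last first.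
  by under eq_fun do rewrite !mxE;
    apply: differentiableBr => //; exact: differentiable_cst.
under eq_fun do rewrite mxE.
apply: differentiable_sumr => l _; apply: differentiableMr; last first.
  by apply: differentiable_invmx => //; rewrite gt_eqF// spd_det_gt0.
by under eq_fun do rewrite !mxE;
  apply: differentiableBr => //; exact: differentiable_cst.
Qed.

Lemma differentiable_nu_delta i :
  differentiable (fun v => nu v + delta x (mu v) (S v) i) a.
Proof. by apply: differentiableDr => //; exact: differentiable_delta. Qed.

Lemma differentiable_gamma_weight i :
  differentiable (fun v => gamma_weight x (nu v) (mu v) (S v) i) a.
Proof.
apply: differentiableMr.
  by apply: differentiableDr => //; exact: differentiable_cst.
apply: differentiableVr; last exact: differentiable_nu_delta.
by rewrite gt_eqF// nu_delta_gt0.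
Qed.

Lemma differentiable_em_weight i :
  differentiable (fun v => em_weight x w (nu v) (mu v) (S v) i) a.
Proof.
apply: differentiableMr; first exact: differentiable_cst.
exact: differentiable_gamma_weight.
Qed.

Lemma differentiable_mu_update i j :
  differentiable (fun v => mu_update x w (nu v, mu v, S v) i j) a.
Proof.
under eq_fun do rewrite mu_updateE mxE summxE.
apply: differentiableMr.
  apply: differentiableVr; first by rewrite gt_eqF// sum_em_weight_gt0.
  by apply: differentiable_sumr => k _; exact: differentiable_em_weight.
apply: differentiable_sumr => k _; under eq_fun do rewrite mxE.
apply: differentiableMr; first exact: differentiable_em_weight.
exact: differentiable_cst.
Qed.

Lemma differentiable_Sigma_update i j :
  differentiable (fun v => Sigma_update x w (nu v, mu v, S v) i j) a.
Proof.
have dc k i' j' : differentiable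
    (fun v => (x k - mu_update x w (nu v, mu v, S v)) i' j') a.
  under eq_fun do rewrite mxE [X in _ + X]mxE.
  apply: differentiableBr; first exact: differentiable_cst.
  exact: differentiable_mu_update.
under eq_fun do rewrite Sigma_updateE mxE summxE.
apply: differentiableMr.
  apply: differentiableVr; first by rewrite gt_eqF// sum_em_weight_gt0.
  by apply: differentiable_sumr => k _; exact: differentiable_em_weight.
apply: differentiable_sumr => k _; under eq_fun do rewrite mxE.
apply: differentiableMr; first exact: differentiable_em_weight.
under eq_fun do rewrite mxE.
apply: differentiable_sumr => l _.
by apply: differentiableMr; [|under eq_fun do rewrite mxE]; exact: dc.
Qed.

Lemma differentiable_b_coef :
  differentiable (fun v => b_coef x w (nu v) (mu v) (S v)) a.
Proof.
apply: differentiable_sumr => i _; apply: differentiableMr.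
  exact: differentiable_cst.
apply: differentiableBr; last exact: differentiable_cst.
apply: differentiableBr; first exact: differentiable_gamma_weight.
apply: differentiable_ln; last exact: differentiable_gamma_weight.
exact: gamma_weight_gt0.
Qed.

Lemma differentiable_ln_det : differentiable (fun v => ln (\det (S v))) a.
Proof.
by apply: differentiable_ln; [exact: spd_det_gt0|exact: differentiable_det].
Qed.

Lemma differentiable_lnGamma (f : V -> R) : 0 < f a -> differentiable f a ->
  differentiable (fun v => ln (Gamma (f v))) a.
Proof. by move=> f0; exact: is_derive_differentiable_comp (lnGamma_derive f0). Qed.

Lemma differentiable_objective :
  differentiable (fun v => objective x w (nu v) (mu v) (S v)) a.
Proof.
have dcst (c : R) : differentiable (fun=> c) a by exact: differentiable_cst.
have dnud : differentiable (fun v => d%:R + nu v) a by exact: differentiableDr.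
apply: differentiableDr; last exact: differentiable_ln_det.
apply: differentiableDr.
  apply: differentiableBr.
    apply: differentiableDr; apply: differentiableMr => //.
      apply: differentiable_lnGamma; first by rewrite divr_gt0// ltr_wpDl.
      exact: differentiableMr.
    apply: differentiable_lnGamma; first by rewrite divr_gt0.
    exact: differentiableMr.
  by apply: differentiableMr => //; exact: differentiable_ln.
apply: differentiableMr => //; apply: differentiable_sumr => i _.
apply: differentiableMr => //; apply: differentiable_ln.
  exact: nu_delta_gt0.
exact: differentiable_nu_delta.
Qed.

End student_t_differentiability.

Section stationary_mu_Sigma.
Context {R : realType} {d n : nat}.
Variables (x : 'I_n -> 'cV[R]_d) (w : 'I_n -> R).
Hypotheses (hw : forall i, 0 < w i) (hw1 : \sum_(i < n) w i = 1).
Variables (nu : R) (mu : 'cV[R]_d) (S : 'M[R]_d).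
Hypotheses (nu0 : 0 < nu) (Ss : spd S)
  (muE : mu_update x w (nu, mu, S) = mu)
  (SE : Sigma_update x w (nu, mu, S) = S)
  (s1 : \sum_i em_weight x w nu mu S i = 1).

Lemma stationary_mu : differentiable (fun m => objective x w nu m S) mu /\
  forall h : 'cV[R]_d, 'd (fun m => objective x w nu m S) mu h = 0.
Proof.
have dcst (c : R) : differentiable (fun=> c) mu by exact: differentiable_cst.
have dm i j : differentiable (fun m : 'cV[R]_d => m i j) mu.
  exact: differentiable_coord.
have df : differentiable (fun m => objective x w nu m S) mu.
  exact: (@differentiable_objective _ _ _ _ x w (fun=> nu) id (fun=> S)).
split=> // h.
apply: (@diff_tangent_majorant _ _ _ (fun m => em_surrogate x w nu mu S m S)) => //.
- apply: differentiableDr => //; apply: differentiable_sumr => i _.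
  apply: differentiableMr => //.
  exact: (@differentiable_delta _ _ _ _ x id (fun=> S)).
- by near=> t; exact: objective_le_surrogate.
- by near=> t; exact: surrogate_min.
Unshelve. all: by end_near. Qed.

Lemma stationary_Sigma : differentiable (objective x w nu mu) S /\
  forall H : 'M[R]_d, H^T = H -> 'd (objective x w nu mu) S H = 0.
Proof.
have dcst (c : R) : differentiable (fun=> c) S by exact: differentiable_cst.
have dT i j : differentiable (fun T : 'M[R]_d => T i j) S.
  exact: differentiable_coord.
have df : differentiable (objective x w nu mu) S.
  exact: (@differentiable_objective _ _ _ _ x w (fun=> nu) (fun=> mu) id).
split=> // H HH.
have [e e0 He] := spd_perturb Ss HH.
have nearS : \forall t \near (0 : R), spd (t *: H + S).
  apply/nbhs_ballP; exists e => //= t.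
  by rewrite /ball/= sub0r normrN; exact: He.
apply: (@diff_tangent_majorant _ _ _ (em_surrogate x w nu mu S mu)) => //.
- apply: differentiableDr; last exact: (@differentiable_ln_det _ _ _ id).
  apply: differentiable_sumr => i _; apply: differentiableMr => //.
  exact: (@differentiable_delta _ _ _ _ x (fun=> mu) id).
- by apply: filterS nearS => t tS; exact: objective_le_surrogate.
- by apply: filterS nearS => t tS; exact: surrogate_min.
Qed.

End stationary_mu_Sigma.

(** * The limit along a cluster point *)

Local Opaque objective.

(** * The nu-updates as zeros of the derivative of a majorant *)

Section nu_step.
Context {R : realType} {d n : nat}.
Variables (x : 'I_n -> 'cV[R]_d) (w : 'I_n -> R).
Hypotheses (hw : forall i, 0 < w i) (hw1 : \sum_(i < n) w i = 1).

(* F nu_r b is the derivative of a convex majorant of the objective in nu,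
   touching it at nu_r: both algorithms only use these properties of F. *)
Record nu_majorant (F : R -> R -> R -> R) : Prop := NuMajorant {
  nu_majorant_nondecr : forall nu_r b v v',
    0 < v -> v <= v' -> F nu_r b v <= F nu_r b v' ;
  nu_majorant_ge : forall nu_r b v, 0 < nu_r -> nu_r <= v ->
    phi (v / 2) - phi ((v + d%:R) / 2) + b <= F nu_r b v ;
  nu_majorant_le : forall nu_r b v, 0 < v -> v <= nu_r ->
    F nu_r b v <= phi (v / 2) - phi ((v + d%:R) / 2) + b ;
  nu_majorant_continuous : forall nu_r b v, 0 < v ->
    {for v, continuous (F nu_r b)} ;
  nu_majorant_continuous2 : forall nu_r b v, 0 < nu_r ->
    {for (nu_r, b), continuous (fun ab : R * R => F ab.1 ab.2 v)}
}.

Lemma phi_half_nondecr (v v' : R) : 0 < v -> v <= v' ->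
  phi (v / 2) - phi ((v + d%:R) / 2) <= phi (v' / 2) - phi ((v' + d%:R) / 2).
Proof.
move=> v0 vv; have d0 : 0 <= d%:R / 2 :> R by rewrite divr_ge0.
have v20 : 0 < v / 2 by rewrite divr_gt0.
have vv2 : v / 2 <= v' / 2 by rewrite ler_pM2r.
have := phi_shift_nonincr d0 v20 vv2; rewrite -!mulrDl.
by lra.
Qed.

Lemma continuous_phi_half (v : R) : 0 < v ->
  {for v, continuous (fun v : R => phi (v / 2))}.
Proof.
move=> v0; apply: (@continuous_comp _ _ _ (fun v : R => v / 2) (@phi R)).
  exact: mulrr_continuous.
by apply: continuous_phi; rewrite divr_gt0.
Qed.

Lemma continuous_phi_shift_half (v : R) : 0 < v ->
  {for v, continuous (fun v : R => phi ((v + d%:R) / 2))}.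
Proof.
move=> v0; apply: (@continuous_comp _ _ _ (fun v : R => v + d%:R)
  (fun v : R => phi (v / 2))).
  by apply: continuousD; [exact: cvg_id|exact: cst_continuous].
by apply: continuous_phi_half; rewrite ltr_wpDr.
Qed.

(** aEM freezes the second argument of phi at nu_r, so both comparisons follow from the monotonicity
    of phi. *)
Lemma nu_majorant_aEM : nu_majorant (@aEM_fun R d).
Proof.
split; rewrite /aEM_fun.
- move=> nu_r b v v' v0 vv; rewrite lerD2r lerD2r phi_nondecr ?divr_gt0//.
  by rewrite ler_pM2r.
- move=> nu_r b v nr0 le; rewrite lerD2r lerD2l lerN2 phi_nondecr//.
    by rewrite divr_gt0// ltr_wpDr.
  by rewrite ler_pM2r// lerD2r.
- move=> nu_r b v v0 le; rewrite lerD2r lerD2l lerN2 phi_nondecr//.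
    by rewrite divr_gt0// ltr_wpDr.
  by rewrite ler_pM2r// lerD2r.
- move=> nu_r b v v0; apply: continuousD; last exact: cst_continuous.
  by apply: continuousB; [exact: continuous_phi_half|exact: cst_continuous].
- move=> nu_r b v nr0; apply: continuousD; last exact: cvg_snd.
  apply: continuousB; first exact: cst_continuous.
  apply: (@continuous_comp _ _ _ fst (fun a : R => phi ((a + d%:R) / 2))).
    exact: cvg_fst.
  exact: continuous_phi_shift_half.
Qed.

(** Here the comparisons are equalities, and concavity of phi enters through the monotonicity in
    nu. *)
Lemma nu_majorant_MMF : nu_majorant (@MMF_fun R d).
Proof.
split; rewrite /MMF_fun.
- by move=> nu_r b v v' v0 vv; rewrite lerD2r phi_half_nondecr.
- by [].
- by [].
- move=> nu_r b v v0; apply: continuousD; last exact: cst_continuous.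
  apply: continuousB; first exact: continuous_phi_half.
  exact: continuous_phi_shift_half.
- move=> nu_r b v nr0.
  by apply: continuousD; [exact: cst_continuous|exact: cvg_snd].
Qed.

Variable F : R -> R -> R -> R.
Hypothesis HF : nu_majorant F.

Lemma nu_majorant_touch (nu : R) mu S : 0 < nu ->
  F nu (b_coef x w nu mu S) nu = nu_grad x w nu mu S.
Proof.
move=> nu0; apply/eqP; rewrite eq_le.
by rewrite (nu_majorant_le HF) ?(nu_majorant_ge HF).
Qed.

(** For t between [v] and [nu'], on the right of [nu], dL/dnu at t is at most [F] at t, hence at
    most [F] at [nu'], which is 0. On the left all signs are reversed. *)
Lemma nu_step_between (nu nu' v : R) mu S : 0 < nu -> 0 < nu' -> 0 < v ->
  spd S -> F nu (b_coef x w nu mu S) nu' = 0 ->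
  (nu <= v <= nu') || (nu' <= v <= nu) ->
  objective x w nu' mu S <= objective x w v mu S.
Proof.
move=> nu0 nu'0 v0 Ss F0 /orP[/andP[h1 h2]|/andP[h1 h2]].
  apply: (@le0_derive_nonincr _ (fun t => objective x w t mu S)
    (fun t => nu_grad x w t mu S)) => // t /andP[t1 t2].
    by apply: objective_derive_nu => //; exact: lt_le_trans t1.
  have t0 := lt_le_trans v0 t1; have nt := le_trans h1 t1.
  rewrite -F0; apply: le_trans (nu_majorant_nondecr HF _ _ t0 t2).
  apply: le_trans (nu_majorant_ge HF _ nu0 nt).
  by rewrite lerD2l b_coef_nonincr.
rewrite -lerN2.
apply: (@le0_derive_nonincr _ (fun t => - objective x w t mu S)
  (fun t => - nu_grad x w t mu S)) => // t /andP[t1 t2].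
  apply: is_deriveN; apply: objective_derive_nu => //; exact: lt_le_trans t1.
have t0 := lt_le_trans nu'0 t1; have tn := le_trans t2 h2.
rewrite oppr_le0 -F0; apply: le_trans (nu_majorant_nondecr HF _ _ nu'0 t1) _.
apply: le_trans (nu_majorant_le HF _ t0 tn) _.
by rewrite lerD2l b_coef_nonincr.
Qed.

Lemma nu_step_le (nu nu' : R) mu S : 0 < nu -> 0 < nu' -> spd S ->
  F nu (b_coef x w nu mu S) nu' = 0 ->
  objective x w nu' mu S <= objective x w nu mu S.
Proof.
move=> nu0 nu'0 Ss F0; apply: (nu_step_between nu0 nu'0 nu0 Ss F0).
by rewrite lexx/= andbT le_total.
Qed.

(** The sign condition says that the majorant still decreases at [v] when coming from [nu], so the
    zero [nu'] lies at or beyond [v]. Being strict, the condition is stable under small changes of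
    the state. *)
Lemma nu_step_descent (nu nu' v : R) mu S : 0 < nu -> 0 < nu' -> 0 < v ->
  spd S -> F nu (b_coef x w nu mu S) nu' = 0 ->
  (v - nu) * F nu (b_coef x w nu mu S) v < 0 ->
  objective x w nu' mu S <= objective x w v mu S.
Proof.
move=> nu0 nu'0 v0 Ss F0 Fv; apply: (nu_step_between nu0 nu'0 v0 Ss F0).
move: Fv; set f := F _ _ v => Fv.
have [nv|nv|nv] := ltgtP nu v.
- have f0 : f < 0 by move: Fv; rewrite pmulr_rlt0// subr_gt0.
  apply/orP; left; rewrite andTb leNgt; apply/negP => /ltW h.
  have := nu_majorant_nondecr HF nu (b_coef x w nu mu S) nu'0 h.
  by rewrite F0 leNgt f0.
- have f0 : 0 < f by move: Fv; rewrite nmulr_rlt0// subr_lt0.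
  apply/orP; right; rewrite andbT leNgt; apply/negP => /ltW h.
  have := nu_majorant_nondecr HF nu (b_coef x w nu mu S) v0 h.
  by rewrite F0 leNgt f0.
- by move: Fv; rewrite nv subrr mul0r ltxx.
Qed.

End nu_step.

Lemma differentiable_fst {R : realType} (U V : normedModType R) (q : U * V) :
  differentiable (@fst U V) q.
Proof. by apply: linear_differentiable => r; exact: cvg_fst. Qed.

Lemma differentiable_snd {R : realType} (U V : normedModType R) (q : U * V) :
  differentiable (@snd U V) q.
Proof. by apply: linear_differentiable => r; exact: cvg_snd. Qed.

Section cluster_point.
Context {R : realType} {d n : nat}.
Variables (x : 'I_n -> 'cV[R]_d) (w : 'I_n -> R).
Hypotheses (hw : forall i, 0 < w i) (hw1 : \sum_(i < n) w i = 1).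
Local Notation state := (R * 'cV[R]_d * 'M[R]_d)%type.
Variables (F : R -> R -> R -> R) (z : nat -> state) (p : state).
Hypotheses (HF : @nu_majorant R d F) (hz : generated_by x w F z)
  (hp : domain p) (hcl : cluster (z @ \oo) p).

Local Notation L q := (objective x w q.1.1 q.1.2 q.2).
Local Notation M q :=
  (objective x w q.1.1 (mu_update x w q) (Sigma_update x w q)).

Lemma state_eta (q : state) : (q.1.1, q.1.2, q.2) = q.
Proof. by case: q => [[]]. Qed.

(** The matrix of [z 1] is the update of [z 0] and is positive definite; [spd_wcov] carries this
    over to the weights of any state, in particular of [p]. *)
Lemma spd_Sigma_update (q : state) : domain q -> spd (Sigma_update x w q).
Proof.
move=> [q0 qs]; have [z0 z0s] := hz.1 0%N.
have : spd (Sigma_update x w (z 0%N)).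
  have := hz.2 0%N; rewrite /step; have := hz.1 1%N.
  by case: (z 1%N) => [[nu1 mu1] S1] [_ /= S1s] [_ <- _].
rewrite -(state_eta q) -(state_eta (z 0%N)) !Sigma_updateE.
apply: spd_wcov => [i|i||].
- exact: em_weight_gt0.
- exact: em_weight_gt0.
- exact: sum_em_weight_gt0.
- exact: sum_em_weight_gt0.
Qed.

Lemma objective_update_le (q : state) : domain q -> M q <= L q.
Proof.
move=> qd; have := spd_Sigma_update qd.
case: q qd => [[nu mu] S] [/= nu0 Ss] S's.
by have [] := objective_em_step hw hw1 nu0 Ss S's.
Qed.

Lemma objective_step_le r : L (z r.+1) <= M (z r).
Proof.
have := hz.2 r; have [z0 _] := hz.1 r; have [z1 _] := hz.1 r.+1.
have Sz := spd_Sigma_update (hz.1 r); rewrite /step.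
case: (z r.+1) z1 => [[nu1 mu1] S1] /= z1 [-> -> F0].
exact: (nu_step_le hw hw1 HF).
Qed.

Lemma objective_nonincr r k : (r <= k)%N -> L (z k) <= L (z r).
Proof.
move=> rk; rewrite -(subnK rk) addnC.
elim: (k - r)%N => [|m ih]; first by rewrite addn0.
rewrite addnS; apply: le_trans ih; apply: le_trans (objective_step_le _) _.
exact/objective_update_le/hz.1.
Qed.

Let dp1 : differentiable (fun q : state => q.1.1) p.
Proof.
apply: (@differentiable_comp _ _ _ _ (fun q : state => q.1) fst).
  exact: differentiable_fst.
exact: differentiable_fst.
Qed.

Let dp2 i j : differentiable (fun q : state => q.1.2 i j) p.
Proof.
apply: (@differentiable_comp _ _ _ _ (fun q : state => q.1.2)
  (fun m : 'cV[R]_d => m i j)); last exact: differentiable_coord.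
apply: (@differentiable_comp _ _ _ _ (fun q : state => q.1) snd).
  exact: differentiable_fst.
exact: differentiable_snd.
Qed.

Let dp3 i j : differentiable (fun q : state => q.2 i j) p.
Proof.
apply: (@differentiable_comp _ _ _ _ (fun q : state => q.2)
  (fun T : 'M[R]_d => T i j)); last exact: differentiable_coord.
exact: differentiable_snd.
Qed.

Let dmu i j : differentiable (fun q : state => mu_update x w q i j) p.
Proof.
rewrite (_ : (fun q => _) = fun q => mu_update x w (q.1.1, q.1.2, q.2) i j).
  by case: hp => p0 ps; exact: differentiable_mu_update.
by apply/funext => q; rewrite state_eta.
Qed.

Let dSigma i j : differentiable (fun q : state => Sigma_update x w q i j) p.
Proof.
rewrite (_ : (fun q => _) = fun q => Sigma_update x w (q.1.1, q.1.2, q.2) i j).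
  by case: hp => p0 ps; exact: differentiable_Sigma_update.
by apply/funext => q; rewrite state_eta.
Qed.

(* The sequence may be replaced by a filter G that converges to p and contains
   every property shared by the tails of the sequence. *)
Lemma cluster_filter : exists2 G : set_system state, ProperFilter G &
  (forall f : state -> R, differentiable f p -> f @ G --> f p) /\
  (forall (P : state -> Prop) N,
    (forall r, (N <= r)%N -> P (z r)) -> \forall q \near G, P q).
Proof.
move: hcl; rewrite cluster_cvgE => -[G PG [Gp zG]]; exists G => //; split.
  by move=> f /differentiable_continuous cf; apply: cvg_trans cf; exact: cvg_app.
move=> P N Pz; apply: zG; exists N => // r /=; exact: Pz.
Qed.

Lemma objective_cluster_le r : L p <= L (z r).
Proof.
have [G PG [Gc Gz]] := cluster_filter; case: hp => p0 ps.
have dL : differentiable (fun q => L q) p by exact: differentiable_objective.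
apply: (cvgr_to_le (Gc _ dL)); apply: (Gz _ r) => k; exact: objective_nonincr.
Qed.

(** L(p) <= L(z_(k+1)) <= M(z_k) for all k, and M is continuous at [p]. Hence L(p) <= M(p), which is
    the equality case of the descent. *)
Lemma cluster_fixed : [/\ mu_update x w p = p.1.2, Sigma_update x w p = p.2
  & \sum_i em_weight x w p.1.1 p.1.2 p.2 i = 1].
Proof.
have [G PG [Gc Gz]] := cluster_filter; case: (hp) => p0 ps.
have Sp := spd_Sigma_update hp.
have dM : differentiable (fun q => M q) p by exact: differentiable_objective.
have LM : L p <= M p.
  apply: (cvgr_to_ge (Gc _ dM)); apply: (Gz _ 0%N) => k _.
  exact: le_trans (objective_cluster_le k.+1) (objective_step_le k).
have ML := objective_update_le hp.
have E : M p = L p by apply/eqP; rewrite eq_le ML LM.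
move: E Sp p0 ps; case: p => [[nu mu] S] /= E S's nu0 Ss.
have [_] := objective_em_step hw hw1 nu0 Ss S's; exact.
Qed.

Local Notation b q := (b_coef x w q.1.1 (mu_update x w q) (Sigma_update x w q)).

(** The strict condition passes from [p] to iterates z_r near [p]. Their next nu lies at or beyond
    [v], so L(p) <= L(z_(r+1)) is at most L at [v] with the updated mu and Sigma, which tend to
    those of [p]. *)
Lemma nu_grad_nbhs_le (v : R) : 0 < v ->
  (v - p.1.1) * F p.1.1 (b p) v < 0 -> L p <= objective x w v p.1.2 p.2.
Proof.
move=> v0 Fv; have [G PG [Gc Gz]] := cluster_filter; case: (hp) => p0 ps.
have Sp := spd_Sigma_update hp; have [muE SE _] := cluster_fixed.
have db : differentiable (fun q => b q) p by exact: differentiable_b_coef.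
have GF : \forall q \near G, (v - q.1.1) * F q.1.1 (b q) v < 0.
  have cF : F q.1.1 (b q) v @[q --> G] --> F p.1.1 (b p) v.
    apply: (@continuous2_cvg _ R R R G _ (fun q => q.1.1) (fun q => b q)
      (fun a c => F a c v)).
    - exact: (nu_majorant_continuous2 HF).
    - exact: (Gc _ dp1).
    - exact: (Gc _ db).
  have c : (v - q.1.1) * F q.1.1 (b q) v @[q --> G] -->
      (v - p.1.1) * F p.1.1 (b p) v.
    by apply: cvgM => //; apply: cvgB; [exact: cvg_cst|exact: (Gc _ dp1)].
  by apply: (cvgr_lt _ c).
(* Nearby states must be actual iterates in order to have a successor. *)
have Gq : \forall q \near G, exists r, q = z r.
  by apply: (Gz _ 0%N) => r _; exists r.
have dQ : differentiable
    (fun q => objective x w v (mu_update x w q) (Sigma_update x w q)) p.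
  exact: (@differentiable_objective _ _ _ _ x w (fun=> v)).
have -> : objective x w v p.1.2 p.2 =
    objective x w v (mu_update x w p) (Sigma_update x w p) by rewrite muE SE.
apply: (cvgr_to_ge (Gc _ dQ)); apply: filterS2 GF Gq => q Fr [r qE].
rewrite {q}qE in Fr *.
have := hz.2 r; have [zr0 _] := hz.1 r; have [z1 _] := hz.1 r.+1.
have Sz := spd_Sigma_update (hz.1 r).
have := objective_cluster_le r.+1; rewrite /step.
case: (z r.+1) z1 => [[nu1 mu1] S1] /= z1 Lp [muE1 SE1 F0].
rewrite -muE1 -SE1 in F0 Fr Sz *.
apply: (le_trans Lp); exact: (nu_step_descent hw hw1 HF zr0 z1 v0 Sz F0 Fr).
Qed.

Lemma cluster_nu_grad : nu_grad x w p.1.1 p.1.2 p.2 = 0.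
Proof.
have [muE SE _] := cluster_fixed; case: (hp) => p0 ps.
set g := nu_grad _ _ _ _ _; apply/eqP; apply: contraT => g0.
have touch : F p.1.1 (b p) p.1.1 = g.
  by rewrite muE SE; exact: (nu_majorant_touch _ _ HF).
(* Moving against a nonzero gradient keeps [F] of the sign of g for small t > 0, so L stays at least
   L(p) along the line; yet its derivative at t = 0 is -g^2 < 0. *)
pose line (t : R) := p.1.1 - t * g.
have line0 : line 0 = p.1.1 by rewrite /line mul0r subr0.
have cline : {for 0, continuous line}.
  apply: continuousB; first exact: cst_continuous.
  exact: mulrr_continuous.
have line_gt0 : \forall t \near 0, 0 < line t.
  by apply: (cvgr_gt _ cline); rewrite line0.
have gF : \forall t \near 0, 0 < g * F p.1.1 (b p) (line t).
  have c : {for 0, continuous (fun t => g * F p.1.1 (b p) (line t))}.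
    apply: continuousM; first exact: cst_continuous.
    apply: (@continuous_comp _ _ _ line (F p.1.1 (b p))) => //.
    by apply: (nu_majorant_continuous HF); rewrite line0.
  apply: (cvgr_gt _ c).
  by rewrite line0 touch -expr2 exprn_even_gt0.
pose f (t : R) := objective x w (line t) p.1.2 p.2.
have df : is_derive (0 : R) 1 f (g * - g).
  have d0 : is_derive (line 0) 1 (fun s => objective x w s p.1.2 p.2) g.
    by rewrite line0; exact: objective_derive_nu.
  have dl : is_derive (0 : R) 1 line (- g).
    by apply: is_derive_eq; rewrite /GRing.scale/=; ring.
  exact: (is_derive1_comp d0 dl).
have fge : \forall t \near 0^'+, f 0 <= f t.
  have l0 : \forall t \near 0^'+, 0 < line t by exact: cvg_within line_gt0.
  have gF' : \forall t \near 0^'+, 0 < g * F p.1.1 (b p) (line t).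
    exact: cvg_within gF.
  near=> t; rewrite /f line0; apply: nu_grad_nbhs_le; first by near: t.
  have t0 : 0 < t by [].
  have : 0 < g * F p.1.1 (b p) (line t) by near: t.
  rewrite [X in (X - _) * _]/line addrAC subrr sub0r mulNr -mulrA oppr_lt0.
  by move=> ?; rewrite mulr_gt0.
have [dv dE] := df.
have cv : (fun h => h^-1 *: (f (h *: 1 + 0) - f 0)) @ 0^' --> 'D_1 f 0.
  exact: dv.
have : 0 <= 'D_1 f 0.
  apply: (cvgr_to_ge (cvg_dnbhs_at_right cv)); near=> t.
  apply: mulr_ge0; first by rewrite invr_ge0 ltW.
  by rewrite addr0 [_ *: _]mulr1 subr_ge0; near: t.
rewrite dE mulrN oppr_ge0 -expr2 => h.
by move: h; rewrite leNgt exprn_even_gt0//= g0.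
Unshelve. all: by end_near. Qed.

Lemma cluster_critical : critical_point x w p.
Proof.
have [muE SE s1] := cluster_fixed; have := cluster_nu_grad.
move: hp muE SE s1; case: p => [[nu mu] S] [/= nu0 Ss] muE SE s1 g0.
split.
- by rewrite -g0; exact: objective_derive_nu.
- exact: stationary_mu.
- exact: stationary_Sigma.
Qed.

End cluster_point.

Unset Implicit Arguments.
Set Strict Implicit.

Theorem theorem5p7 (R : realType) (d n : nat) (hn : (d + 1 <= n)%N)
  (x : 'I_n -> 'cV[R]_d) (w : 'I_n -> R)
  (hw : forall i, 0 < w i) (hw1 : \sum_(i < n) w i = 1)
  (z : nat -> R * 'cV[R]_d * 'M[R]_d)
  (hz : generated_by x w (@aEM_fun R d) z \/ generated_by x w (@MMF_fun R d) z)
  (p : R * 'cV[R]_d * 'M[R]_d) (hp : domain p)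
  (hcl : cluster (z @ \oo) p) :
  critical_point x w p.
Proof.
case: hz => hz'.
  exact: (cluster_critical hw hw1 (@nu_majorant_aEM R d) hz' hp hcl).
exact: (cluster_critical hw hw1 (@nu_majorant_MMF R d) hz' hp hcl).
Qed.
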